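(* Let $s,\tau\in\mathbb{R}$ with $s\tau\neq0$, and put $\sigma=\tau^2-2p^2\tau+r^4$, $4s^2\chi^2=\sigma+4s^2\tau$. Consider a solution of the generalized Kowalevski top equations (see context) lying on the third critical subsystem $\mathcal{M}_3$ with $S=s$, $T=\tau$. Let $x$ be a real square root of $x_1x_2$ (chosen continuously along the solution), $\xi=x_1x_2+z_1z_2-\tau$; then $\mu^2:=\tau\xi^2+\sigma x^2-\tau\sigma\ge 0$. Let $$t_1=\frac{\tau\xi+\mu x}{\tau-x^2},\qquad t_2=\frac{\tau\xi-\mu x}{\tau-x^2}$$ be the two (real) roots of $(\tau-x^2)t^2-2\tau\xi t+\tau\xi^2+\sigma x^2=0$. On any time interval on which $x\ne0$, $x^2\neq\tau$, $t_1^2\ne t_2^2$, the following holds. (i) At each moment there is a choice of (complex) values of the radicals $$\sqrt{s\tau},\quad U_j=\sqrt{t_j^2-\sigma},\quad V_j=\sqrt{4s^2\chi^2-t_j^2},\quad M_j=\sqrt{t_j+\tau+r^2},\quad N_j=\sqrt{t_j+\tau-r^2}\quad(j=1,2),$$ $$R=\sqrt{t_1t_2+\sigma+U_1U_2},$$ such that, with $\sqrt{2s\tau}=\sqrt2\sqrt{s\tau}$ and $$\mathcal{A}=[(t_1+\tau+r^2)(t_2+\tau+r^2)-2(p^2+r^2)r^2]\tau,\qquad \mathcal{B}=[(t_1+\tau-r^2)(t_2+\tau-r^2)+2(p^2-r^2)r^2]\tau,$$ all phase variables are given by $$\alpha_1=\frac{(\mathcal{A}-r^2U_1U_2)(4s^2\tau+U_1U_2)-(\tau+r^2)M_1N_1M_2N_2V_1V_2}{4r^2s\tau(U_1+U_2)^2},$$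 $$\alpha_2=\mathrm{i}\,\frac{(\mathcal{A}-r^2U_1U_2)V_1V_2-(4s^2\tau+U_1U_2)(\tau+r^2)M_1N_1M_2N_2}{4r^2s\tau(U_1+U_2)^2},$$ $$\beta_1=\mathrm{i}\,\frac{(\mathcal{B}+r^2U_1U_2)V_1V_2-(4s^2\tau+U_1U_2)(\tau-r^2)M_1N_1M_2N_2}{4r^2s\tau(U_1+U_2)^2},$$ $$\beta_2=-\frac{(\mathcal{B}+r^2U_1U_2)(4s^2\tau+U_1U_2)-(\tau-r^2)M_1N_1M_2N_2V_1V_2}{4r^2s\tau(U_1+U_2)^2},$$ $$\alpha_3=\frac{R}{r\sqrt2}\,\frac{M_1M_2}{t_1+t_2},\qquad \beta_3=-\mathrm{i}\,\frac{R}{r\sqrt2}\,\frac{N_1N_2}{t_1+t_2},$$ $$\omega_1=\frac{R}{4rs\sqrt{s\tau}}\,\frac{M_2N_1U_1V_2+M_1N_2U_2V_1}{t_1^2-t_2^2},\qquad \omega_2=-\frac{\mathrm{i}R}{4rs\sqrt{s\tau}}\,\frac{M_2N_1U_2V_1+M_1N_2U_1V_2}{t_1^2-t_2^2},$$ $$\omega_3=\frac{U_1-U_2}{\sqrt{2s\tau}}\,\frac{M_2N_2V_1-M_1N_1V_2}{t_1^2-t_2^2}.$$ (ii) The variables $t_1,t_2$ satisfy the separated equations of Kowalevski type $$(t_1-t_2)\frac{dt_j}{dt}=\sqrt{\frac{1}{2s\tau}\,(4s^2\chi^2-t_j^2)(t_j^2-\sigma)\bigl[r^4-(t_j+\tau)^2\bigr]}\,,\qquad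 j=1,2,$$ where each square root stands for one of its two values (for each $j$ the square of the left side equals the radicand).
   Context: Fix constants $a>b>0$ and put $p^2=a^2+b^2$, $r^2=a^2-b^2$ with $p,r>0$. The phase space $\mathcal{P}\subset\mathbb{R}^9$ is the set of $(\omega,\alpha,\beta)\in\mathbb{R}^3\times\mathbb{R}^3\times\mathbb{R}^3$ with $|\alpha|^2=a^2$, $|\beta|^2=b^2$, $\alpha\cdot\beta=0$. The equations of the generalized Kowalevski top (in two constant fields) on $\mathcal{P}$ are $$2\dot\omega_1=\omega_2\omega_3+\beta_3,\quad 2\dot\omega_2=-\omega_1\omega_3-\alpha_3,\quad \dot\omega_3=\alpha_2-\beta_1,\quad \dot\alpha=\alpha\times\omega,\quad \dot\beta=\beta\times\omega .$$ Complex phase variables ($\mathrm{i}^2=-1$): $$x_1=(\alpha_1-\beta_2)+\mathrm{i}(\alpha_2+\beta_1),\quad x_2=\overline{x_1},\quad y_1=(\alpha_1+\beta_2)+\mathrm{i}(\alpha_2-\beta_1),\quad y_2=\overline{y_1},$$ $$z_1=\alpha_3+\mathrm{i}\beta_3,\quad z_2=\overline{z_1},\quad w_1=\omega_1+\mathrm{i}\omega_2,\quad w_2=\overline{w_1},\quad w_3=\omega_3 .$$ The third critical subsystem $\mathcal{M}_3\subset\mathcal{P}$ is the set (considered where $w_1w_2\neq0$) given by $$\frac{w_2x_1+w_1y_2+w_3z_1}{w_1}-\frac{w_1x_2+w_2y_1+w_3z_2}{w_2}=0,$$ $$(w_2z_1+w_1z_2)w_3^2+\Bigl[\frac{w_2z_1^2}{w_1}+\frac{w_1z_2^2}{w_2}+w_1w_2(y_1+y_2)+x_1w_2^2+x_2w_1^2\Bigr]w_3$$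 $$+\frac{w_2^2x_1z_1}{w_1}+\frac{w_1^2x_2z_2}{w_2}+x_1z_2w_2+x_2z_1w_1+(w_1z_2-w_2z_1)(y_1-y_2)=0 .$$ On $\mathcal{M}_3$ one uses the first integrals $$S=-\frac14\Bigl(\frac{y_2w_1+x_1w_2+z_1w_3}{w_1}+\frac{x_2w_1+y_1w_2+z_2w_3}{w_2}\Bigr),$$ $$T=\frac12\bigl[w_1(x_2w_1+y_1w_2+z_2w_3)+w_2(y_2w_1+x_1w_2+z_1w_3)\bigr]+x_1x_2+z_1z_2 .$$ The radicals in the claim may be real or complex (e.g. purely imaginary); ''a choice of values'' means a choice of one of the two square roots for each of them. *)

(* Defs.v *)
(* Stdlib real numbers with Coquelicot (derivatives, complex numbers). *)
From Stdlib Require Import Reals.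
From Coquelicot Require Import Coquelicot.

Set Implicit Arguments.

Local Open Scope R_scope.

Record vec3 := Vec3 { c1 : R; c2 : R; c3 : R }.

Definition dot3 (u v : vec3) : R := c1 u * c1 v + c2 u * c2 v + c3 u * c3 v.

Definition cross3 (u v : vec3) : vec3 :=
  Vec3 (c2 u * c3 v - c3 u * c2 v)
       (c3 u * c1 v - c1 u * c3 v)
       (c1 u * c2 v - c2 u * c1 v).

Definition is_derive3 (f : R -> vec3) (t : R) (v : vec3) : Prop :=
  is_derive (fun u => c1 (f u)) t (c1 v) /\
  is_derive (fun u => c2 (f u)) t (c2 v) /\
  is_derive (fun u => c3 (f u)) t (c3 v).

Record point := Point { omega : vec3; alpha : vec3; beta : vec3 }.

Definition in_phase_space (a b : R) (q : point) : Prop :=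
  dot3 (alpha q) (alpha q) = a ^ 2 /\
  dot3 (beta q) (beta q) = b ^ 2 /\
  dot3 (alpha q) (beta q) = 0.

(* The moments of inertia are (2, 2, 1), whence the factors 1/2. *)
Definition omega_dot (q : point) : vec3 :=
  let w := omega q in
  Vec3 ((c2 w * c3 w + c3 (beta q)) / 2)
       ((- c1 w * c3 w - c3 (alpha q)) / 2)
       (c2 (alpha q) - c1 (beta q)).

Definition top_equations (q : R -> point) (t : R) : Prop :=
  is_derive3 (fun u => omega (q u)) t (omega_dot (q t)) /\
  is_derive3 (fun u => alpha (q u)) t (cross3 (alpha (q t)) (omega (q t))) /\
  is_derive3 (fun u => beta (q u)) t (cross3 (beta (q t)) (omega (q t))).

(* Open interval, possibly unbounded. *)
Definition in_ivl (lo hi : Rbar) (t : R) : Prop :=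
  Rbar_lt lo t /\ Rbar_lt t hi.

Definition x1 (q : point) : C :=
  (RtoC (c1 (alpha q) - c2 (beta q)) + Ci * RtoC (c2 (alpha q) + c1 (beta q)))%C.
Definition x2 (q : point) : C := Cconj (x1 q).
Definition y1 (q : point) : C :=
  (RtoC (c1 (alpha q) + c2 (beta q)) + Ci * RtoC (c2 (alpha q) - c1 (beta q)))%C.
Definition y2 (q : point) : C := Cconj (y1 q).
Definition z1 (q : point) : C :=
  (RtoC (c3 (alpha q)) + Ci * RtoC (c3 (beta q)))%C.
Definition z2 (q : point) : C := Cconj (z1 q).
Definition w1 (q : point) : C :=
  (RtoC (c1 (omega q)) + Ci * RtoC (c2 (omega q)))%C.
Definition w2 (q : point) : C := Cconj (w1 q).
Definition w3 (q : point) : C := RtoC (c3 (omega q)).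

Definition in_M3 (a b : R) (q : point) : Prop :=
  let x1 := x1 q in let x2 := x2 q in
  let y1 := y1 q in let y2 := y2 q in
  let z1 := z1 q in let z2 := z2 q in
  let w1 := w1 q in let w2 := w2 q in let w3 := w3 q in
  in_phase_space a b q /\
  (w1 * w2)%C <> RtoC 0 /\
  ((w2 * x1 + w1 * y2 + w3 * z1) / w1
    - (w1 * x2 + w2 * y1 + w3 * z2) / w2)%C = RtoC 0 /\
  ((w2 * z1 + w1 * z2) * w3 ^ 2
    + (w2 * z1 ^ 2 / w1 + w1 * z2 ^ 2 / w2 + w1 * w2 * (y1 + y2)
       + x1 * w2 ^ 2 + x2 * w1 ^ 2) * w3
    + w2 ^ 2 * x1 * z1 / w1 + w1 ^ 2 * x2 * z2 / w2
    + x1 * z2 * w2 + x2 * z1 * w1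
    + (w1 * z2 - w2 * z1) * (y1 - y2))%C = RtoC 0.

Definition integralS (q : point) : C :=
  (- (RtoC (1 / 4)) *
    ((y2 q * w1 q + x1 q * w2 q + z1 q * w3 q) / w1 q
     + (x2 q * w1 q + y1 q * w2 q + z2 q * w3 q) / w2 q))%C.

Definition integralT (q : point) : C :=
  (RtoC (1 / 2) *
    (w1 q * (x2 q * w1 q + y1 q * w2 q + z2 q * w3 q)
     + w2 q * (y2 q * w1 q + x1 q * w2 q + z1 q * w3 q))
   + x1 q * x2 q + z1 q * z2 q)%C.

(* [Re] loses nothing: [x1 * x2] and [z1 * z2] are squared moduli. *)
Definition xi (tau : R) (q : point) : R :=
  Re (x1 q * x2 q + z1 q * z2 q - RtoC tau)%C.

Definition mu_sq (tau sigma x xi : R) : R :=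
  tau * xi ^ 2 + sigma * x ^ 2 - tau * sigma.

Definition t_plus (tau x xi mu : R) : R := (tau * xi + mu * x) / (tau - x ^ 2).
Definition t_minus (tau x xi mu : R) : R := (tau * xi - mu * x) / (tau - x ^ 2).

Definition calA (p r tau t1 t2 : R) : R :=
  ((t1 + tau + r ^ 2) * (t2 + tau + r ^ 2) - 2 * (p ^ 2 + r ^ 2) * r ^ 2) * tau.
Definition calB (p r tau t1 t2 : R) : R :=
  ((t1 + tau - r ^ 2) * (t2 + tau - r ^ 2) + 2 * (p ^ 2 - r ^ 2) * r ^ 2) * tau.

(* All nine phase variables in terms of [t1], [t2] and the chosen values of the
   radicals; [sqst] is the value of the square root of [s * tau]. *)
Definition explicit_solution (p r s tau t1 t2 : R)
    (sqst U1 U2 V1 V2 M1 M2 N1 N2 Q : C) (q : point) : Prop :=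
  let A := RtoC (calA p r tau t1 t2) in
  let B := RtoC (calB p r tau t1 t2) in
  let sq2st := (RtoC (sqrt 2) * sqst)%C in
  let E := (RtoC (4 * s ^ 2 * tau) + U1 * U2)%C in
  let D := (RtoC (4 * r ^ 2 * s * tau) * (U1 + U2) ^ 2)%C in
  let dt := RtoC (t1 ^ 2 - t2 ^ 2) in
  RtoC (c1 (alpha q)) =
    (((A - r ^ 2 * U1 * U2) * E
       - (tau + r ^ 2) * M1 * N1 * M2 * N2 * V1 * V2) / D)%C /\
  RtoC (c2 (alpha q)) =
    (Ci * (((A - r ^ 2 * U1 * U2) * V1 * V2
       - E * (tau + r ^ 2) * M1 * N1 * M2 * N2) / D))%C /\
  RtoC (c1 (beta q)) =
    (Ci * (((B + r ^ 2 * U1 * U2) * V1 * V2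
       - E * (tau - r ^ 2) * M1 * N1 * M2 * N2) / D))%C /\
  RtoC (c2 (beta q)) =
    (- (((B + r ^ 2 * U1 * U2) * E
       - (tau - r ^ 2) * M1 * N1 * M2 * N2 * V1 * V2) / D))%C /\
  RtoC (c3 (alpha q)) =
    (Q / RtoC (r * sqrt 2) * (M1 * M2 / RtoC (t1 + t2)))%C /\
  RtoC (c3 (beta q)) =
    (- Ci * (Q / RtoC (r * sqrt 2)) * (N1 * N2 / RtoC (t1 + t2)))%C /\
  RtoC (c1 (omega q)) =
    (Q / (RtoC (4 * r * s) * sqst)
       * ((M2 * N1 * U1 * V2 + M1 * N2 * U2 * V1) / dt))%C /\
  RtoC (c2 (omega q)) =
    (- (Ci * Q / (RtoC (4 * r * s) * sqst))
       * ((M2 * N1 * U2 * V1 + M1 * N2 * U1 * V2) / dt))%C /\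
  RtoC (c3 (omega q)) =
    ((U1 - U2) / sq2st * ((M2 * N2 * V1 - M1 * N1 * V2) / dt))%C.

(* Main.v *)
(** On M3 the equations S = s, T = tau and the second defining relation amount to a
    homogeneous linear system for (w1, w2, w3) together with 2 s w1 w2 = xi.  With
    mu_i = r^2 x_i - tau y_i one has mu_1 mu_2 = mu^2 (so mu^2 = |mu_1|^2), and the
    vanishing determinant of the system reads 2 s (mu_1 + mu_2) = 4 s^2 (tau - x^2) + xi^2 - sigma.
    Put K = kap^2 = tau / (tau - x^2) and choose the radicals so that U1 U2 = K (xi^2 - sigma),
    V1 V2 = 2 s K (mu_2 - mu_1), M1 M2 = r kap (z1 + z2), N1 N2 = r kap (z1 - z2),
    R = sqrt 2 kap xi.  Then the formulas for alpha and beta are rational identities.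
    The formulas for omega hold up to a common sign, because the products w1^2, w1 w2, w1 w3
    come out right and w1 <> 0; the choice of sqrt (s tau) fixes the sign.  Working with
    products avoids any case distinction when some radical vanishes.
    For the separated equations, differentiate the quadratic equation of t_j and use that
    tau ((t + tau) z1 - r^2 z2)^2 = ((t + tau)^2 - r^4) x1 mu_2 at its roots. *)
Require Import Defs.
From Stdlib Require Import Reals Lra.
From Coquelicot Require Import Coquelicot.
(* Names of [Defs] such as [c1] and [alpha] are shadowed by the other imports. *)
Import Defs.

Set Implicit Arguments.

Local Open Scope C_scope.

(** * Certificates for complex identities, and complex square roots of real numbers *)

Lemma Ceq_add (a b c d : C) : a = b -> c = d -> a + c = b + d.
Proof. now intros -> ->. Qed.

Lemma Ceq_scale (k a b : C) : a = b -> k * a = k * b.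
Proof. now intros ->. Qed.

(** With [⊕] and [⊙] the hypotheses are assembled into one equation, so the argument of [lincomb] is
    a certificate of ideal membership: its coefficients are the cofactors, and [ring] only checks
    them. *)
Lemma Ceq_shift (a b c d : C) : a = b -> c - d = a - b -> c = d.
Proof.
  intros -> H. apply Ceq_minus. rewrite H. ring.
Qed.

Local Infix "⊕" := Ceq_add (at level 50, left associativity).
Local Infix "⊙" := Ceq_scale (at level 40).

(* Closes [c = d] when [c - d] is the difference of the sides of [e]. *)
Ltac lincomb e := apply (Ceq_shift e); ring.

Lemma Cmult_cancel_l (k a b : C) : k <> 0 -> k * a = k * b -> a = b.
Proof.
  intros hk H.
  replace a with (/ k * (k * a)) by (field; exact hk).
  rewrite H. field; exact hk.
Qed.

Lemma Cdiv_intro (a b c : C) : b <> 0 -> c * b = a -> c = a / b.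
Proof. intros hb <-. field; exact hb. Qed.

Lemma RtoC_neq (a b : R) : a <> b -> RtoC a <> RtoC b.
Proof. intros H E. apply H, RtoC_inj, E. Qed.

Ltac nonzero := repeat first [assumption | apply RtoC_neq; lra | apply Cmult_neq_0].

Lemma Csqr_eq (a b : C) : a ^ 2 = b ^ 2 -> a = b \/ a = - b.
Proof.
  intros H.
  destruct (Ceq_dec a b) as [E|E]; [now left|right].
  apply (@Cmult_cancel_l (a - b)).
  - now apply Cminus_eq_contra.
  - lincomb H.
Qed.

Lemma Ci_sqr : Ci ^ 2 = - (1).
Proof. unfold Ci, Cpow, Cmult, Copp, RtoC; simpl; f_equal; ring. Qed.

Lemma RtoC_sqrt_ex (a : R) : exists w : C, w ^ 2 = RtoC a.
Proof.
  destruct (Rle_dec 0 a) as [h|h].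
  - exists (RtoC (sqrt a)). rewrite <- RtoC_pow, pow2_sqrt; auto.
  - exists (Ci * RtoC (sqrt (- a))).
    rewrite Cpow_mult_l, <- RtoC_pow, pow2_sqrt by lra.
    rewrite RtoC_opp.
    rewrite Ci_sqr.
    ring.
Qed.

(** Start from any root [u] of [a]. If [u <> 0], then [v = P / u] is forced; if [u = 0], then
    [P = 0] and every root of [b] will do. *)
Lemma sqrt_pair_ex (a b : R) (P : C) :
  P ^ 2 = RtoC a * RtoC b ->
  exists u v : C, u ^ 2 = RtoC a /\ v ^ 2 = RtoC b /\ u * v = P.
Proof.
  intros H.
  destruct (RtoC_sqrt_ex a) as [u hu].
  destruct (Ceq_dec u 0) as [E|E].
  - destruct (RtoC_sqrt_ex b) as [v hv].
    exists u, v; repeat split; auto.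
    assert (ha : RtoC a = 0) by (rewrite <- hu, E; ring).
    rewrite ha in H.
    destruct (@Csqr_eq P 0) as [E'|E'].
    + rewrite H; ring.
    + rewrite E, E'; ring.
    + rewrite E, E'; ring.
  - exists u, (P / u); repeat split; auto.
    + apply (@Cmult_cancel_l (u ^ 2)); [now apply Cpow_nz|].
      rewrite hu at 2. rewrite <- H. field; exact E.
    + field; exact E.
Qed.

(** * Polynomial relations at a point of the third critical subsystem *)

(* [X] stands for x^2. *)
Record m3_point (p r s tau sigma X xi x1 x2 y1 y2 z1 z2 w1 w2 w3 : C) : Prop := {
  m3_sigma : sigma = tau ^ 2 - 2 * p ^ 2 * tau + r ^ 4;
  m3_x : x1 * x2 = X;
  m3_z : z1 * z2 = xi + tau - X;
  m3_y : y1 * y2 = 2 * p ^ 2 + X - 2 * xi - 2 * tau;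
  m3_xy1 : x1 * y2 = r ^ 2 - z1 ^ 2;
  m3_xy2 : x2 * y1 = r ^ 2 - z2 ^ 2;
  m3_row1 : (y2 + 2 * s) * w1 + x1 * w2 + z1 * w3 = 0;
  m3_row2 : x2 * w1 + (y1 + 2 * s) * w2 + z2 * w3 = 0;
  m3_row3 : x2 * z1 * w1 + x1 * z2 * w2 + (tau - X) * w3 = 0;
  m3_w : 2 * s * w1 * w2 = xi;
  m3_w1_neq0 : w1 <> 0;
  m3_w2_neq0 : w2 <> 0 }.

(** Symmetry under complex conjugation: each relation with index 1 yields its companion with index
    2. *)
Lemma m3_point_swap p r s tau sigma X xi x1 x2 y1 y2 z1 z2 w1 w2 w3 :
  m3_point p r s tau sigma X xi x1 x2 y1 y2 z1 z2 w1 w2 w3 ->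
  m3_point p r s tau sigma X xi x2 x1 y2 y1 z2 z1 w2 w1 w3.
Proof.
  intros [hs hx hz hy h1 h2 R1 R2 R3 hw hw1 hw2]; constructor; auto.
  - lincomb hx.
  - lincomb hz.
  - lincomb hy.
  - lincomb R2.
  - lincomb R1.
  - lincomb R3.
  - lincomb hw.
Qed.

Section Relations.

Variables p r s tau sigma X xi x1 x2 y1 y2 z1 z2 w1 w2 w3 : C.
Hypothesis H : m3_point p r s tau sigma X xi x1 x2 y1 y2 z1 z2 w1 w2 w3.

Let mu1 := r ^ 2 * x1 - tau * y1.
Let mu2 := r ^ 2 * x2 - tau * y2.

(** Compute [x1 x2 y1 y2] as [(x1 x2)(y1 y2)] and as [(x1 y2)(x2 y1)]; the terms in [X ^ 2] and
    [X (xi + tau)] cancel. *)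
Lemma m3_z_sqr_sum :
  r ^ 2 * (z1 ^ 2 + z2 ^ 2) = r ^ 4 + (xi + tau) ^ 2 - 2 * p ^ 2 * X.
Proof.
  destruct H as [hs hx hz hy h1 h2 _ _ _ _ _ _].
  lincomb ((- X) ⊙ hy ⊕ (x2 * y1) ⊙ h1 ⊕ (r ^ 2 - z1 ^ 2) ⊙ h2
           ⊕ (- (y1 * y2)) ⊙ hx ⊕ (z1 * z2 + xi + tau - X) ⊙ hz).
Qed.

Lemma m3_mu_mul : mu1 * mu2 = tau * xi ^ 2 + sigma * X - tau * sigma.
Proof.
  pose proof m3_z_sqr_sum as A.
  destruct H as [hs hx hz hy h1 h2 _ _ _ _ _ _]. unfold mu1, mu2.
  lincomb (r ^ 4 ⊙ hx ⊕ (- (r ^ 2 * tau)) ⊙ h1 ⊕ (- (r ^ 2 * tau)) ⊙ h2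
    ⊕ tau ^ 2 ⊙ hy ⊕ tau ⊙ A ⊕ (tau - X) ⊙ hs).
Qed.

(* The vanishing of the determinant of the linear system for [w1, w2, w3]. *)
Lemma m3_mu_add :
  2 * s * (mu1 + mu2) = 4 * s ^ 2 * (tau - X) + xi ^ 2 - sigma.
Proof.
  pose proof m3_z_sqr_sum as A.
  destruct H as [hs hx hz hy h1 h2 R1 R2 R3 _ _ hw2]. unfold mu1, mu2.
  assert (D : (y2 + 2 * s) * ((y1 + 2 * s) * (tau - X) - z2 * x1 * z2)
    - x1 * (x2 * (tau - X) - z2 * x2 * z1)
    + z1 * (x2 * x1 * z2 - (y1 + 2 * s) * x2 * z1) = 0).
  (* The coefficients are the cofactors of the column of [w2], so the combination of rows is [w2]
     times the determinant. *)
  { apply (@Cmult_cancel_l w2); [exact hw2|].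
    lincomb ((- (x2 * (tau - X) - z2 * x2 * z1)) ⊙ R1
      ⊕ ((y2 + 2 * s) * (tau - X) - z1 * x2 * z1) ⊙ R2
      ⊕ (- ((y2 + 2 * s) * z2 - z1 * x2)) ⊙ R3). }
  lincomb ((-(1)) ⊙ D ⊕ (- (2 * s * x2) - z2 ^ 2) ⊙ h1 ⊕ (- (2 * s * x1) - z1 ^ 2) ⊙ h2
     ⊕ (tau - X) ⊙ hy ⊕ (-(1)) ⊙ A ⊕ 1 ⊙ hs
     ⊕ (2 * s * (y1 + y2) - (tau - X) + 2 * z1 * z2) ⊙ hx ⊕ (2 * (z1 * z2 + xi + tau)) ⊙ hz).
Qed.

(** After multiplication by [w2] the left side is [xi x2 w1], and eliminating [w3] between [m3_row2]
    and [m3_row3] expresses this through [w2] alone. *)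
Lemma m3_w1_sqr : 2 * s * x2 * w1 ^ 2 = 2 * s * (tau - X) - mu1.
Proof.
  destruct H as [hs hx hz hy h1 h2 R1 R2 R3 hw _ hw2]. unfold mu1.
  apply (@Cmult_cancel_l w2); [exact hw2|].
  lincomb ((x2 * w1) ⊙ hw ⊕ (-(tau - X)) ⊙ R2 ⊕ z2 ⊙ R3
     ⊕ (- (x2 * w1)) ⊙ hz ⊕ (- (x1 * w2)) ⊙ h2 ⊕ (y1 * w2) ⊙ hx).
Qed.

(** The same device with [w1] eliminated: [m3_row3] minus [z1] times [m3_row2] relates [xi w3] to
    [w2]. *)
Lemma m3_w1_w3 : 2 * s * w1 * w3 = x1 * z2 - z1 * y1 - 2 * s * z1.
Proof.
  destruct H as [hs hx hz hy h1 h2 R1 R2 R3 hw _ hw2].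
  apply (@Cmult_cancel_l w2); [exact hw2|].
  lincomb (w3 ⊙ hw ⊕ (-(1)) ⊙ R3 ⊕ z1 ⊙ R2 ⊕ (- w3) ⊙ hz).
Qed.

End Relations.

(** * Symmetric functions of the roots [t1], [t2] *)

Section Explicit.

Variables p r s tau sigma X xi x1 x2 y1 y2 z1 z2 w1 w2 w3 : C.
Hypothesis H : m3_point p r s tau sigma X xi x1 x2 y1 y2 z1 z2 w1 w2 w3.

Let mu1 := r ^ 2 * x1 - tau * y1.
Let mu2 := r ^ 2 * x2 - tau * y2.

Variables K t1 t2 : C.
(** [K] stands for [tau / (tau - X)], so that [X / (tau - X)] is [K - 1]; [hsum] and [hprod] are
    then Vieta's formulas for the quadratic equation. *)
Hypothesis hK : K * (tau - X) = tau.
Hypothesis hsum : t1 + t2 = 2 * K * xi.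
Hypothesis hprod : t1 * t2 = K * (xi ^ 2 + sigma) - sigma.

(** Vieta's formulas make the left side affine in [K], while [m3_z_sqr_sum] and [m3_z] evaluate
    [(z1 + z2) ^ 2]. This admits [r kap (z1 + z2)] as a value of [M1 M2]. *)
Lemma roots_shift_add :
  (t1 + tau + r ^ 2) * (t2 + tau + r ^ 2) = K * r ^ 2 * (z1 + z2) ^ 2.
Proof.
  pose proof (m3_z_sqr_sum H) as A.
  destruct H as [hs hx hz hy h1 h2 _ _ _ _ _ _].
  lincomb (1 ⊙ hprod ⊕ (tau + r ^ 2) ⊙ hsum ⊕ (- K) ⊙ A
    ⊕ (- (2 * K * r ^ 2)) ⊙ hz ⊕ (K - 1) ⊙ hs ⊕ (- (2 * (p ^ 2 + r ^ 2))) ⊙ hK).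
Qed.

Lemma roots_shift_sub :
  (t1 + tau - r ^ 2) * (t2 + tau - r ^ 2) = K * r ^ 2 * (z1 - z2) ^ 2.
Proof.
  pose proof (m3_z_sqr_sum H) as A.
  destruct H as [hs hx hz hy h1 h2 _ _ _ _ _ _].
  lincomb (1 ⊙ hprod ⊕ (tau - r ^ 2) ⊙ hsum ⊕ (- K) ⊙ A
    ⊕ (2 * K * r ^ 2) ⊙ hz ⊕ (K - 1) ⊙ hs ⊕ (- (2 * (p ^ 2 - r ^ 2))) ⊙ hK).
Qed.

Lemma mu_sqr_scaled : K * (mu1 * mu2) = tau * (K * xi ^ 2 - sigma).
Proof.
  unfold mu1, mu2. rewrite (m3_mu_mul H). lincomb ((- sigma) ⊙ hK).
Qed.

Lemma roots_sqr_sum : t1 ^ 2 + t2 ^ 2 - 2 * sigma = 4 * K * (K * xi ^ 2 - sigma)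
  - 2 * (K * (xi ^ 2 - sigma)).
Proof.
  transitivity ((t1 + t2) ^ 2 - 2 * (t1 * t2) - 2 * sigma); [ring|].
  rewrite hsum, hprod. ring.
Qed.

(** The product is [(t1 t2 + sigma) ^ 2 - sigma (t1 + t2) ^ 2], a perfect square since
    [t1 t2 + sigma = K (xi ^ 2 + sigma)]. This admits [K (xi ^ 2 - sigma)] as a value of [U1 U2]. *)
Lemma roots_sqr_prod :
  (t1 ^ 2 - sigma) * (t2 ^ 2 - sigma) = (K * (xi ^ 2 - sigma)) ^ 2.
Proof.
  transitivity ((t1 * t2 + sigma) ^ 2 - sigma * (t1 + t2) ^ 2); [ring|].
  rewrite hsum, hprod. ring.
Qed.

Lemma det_scaled :
  4 * s ^ 2 * tau + K * (xi ^ 2 - sigma) = 2 * s * K * (mu1 + mu2).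
Proof.
  pose proof (m3_mu_add H) as D. fold mu1 mu2 in D.
  lincomb ((- (4 * s ^ 2)) ⊙ hK ⊕ (- K) ⊙ D).
Qed.

(** Write [(mu2 - mu1) ^ 2] as [(mu1 + mu2) ^ 2 - 4 mu1 mu2]: the determinant relation gives the
    sum, [mu_sqr_scaled] the product. *)
Lemma radicand_V_prod :
  (sigma + 4 * s ^ 2 * tau - t1 ^ 2) * (sigma + 4 * s ^ 2 * tau - t2 ^ 2)
  = (2 * s * K * (mu2 - mu1)) ^ 2.
Proof.
  transitivity ((4 * s ^ 2 * tau) ^ 2
    - 4 * s ^ 2 * tau * (t1 ^ 2 + t2 ^ 2 - 2 * sigma)
    + (t1 ^ 2 - sigma) * (t2 ^ 2 - sigma)); [ring|].
  transitivity ((2 * s * K * (mu1 + mu2)) ^ 2 - 16 * s ^ 2 * K * (K * (mu1 * mu2)));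
    [|ring].
  rewrite roots_sqr_sum, roots_sqr_prod, <- det_scaled, mu_sqr_scaled. ring.
Qed.

(** * Products of the radicals and the formulas for [alpha] and [beta] *)

Variables U1 U2 V1 V2 M1 M2 N1 N2 kap : C.
Hypothesis hkap : kap ^ 2 = K.
Hypothesis hU1 : U1 ^ 2 = t1 ^ 2 - sigma.
Hypothesis hU2 : U2 ^ 2 = t2 ^ 2 - sigma.
Hypothesis hV1 : V1 ^ 2 = sigma + 4 * s ^ 2 * tau - t1 ^ 2.
Hypothesis hV2 : V2 ^ 2 = sigma + 4 * s ^ 2 * tau - t2 ^ 2.
Hypothesis hM1 : M1 ^ 2 = t1 + tau + r ^ 2.
Hypothesis hM2 : M2 ^ 2 = t2 + tau + r ^ 2.
Hypothesis hN1 : N1 ^ 2 = t1 + tau - r ^ 2.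
Hypothesis hN2 : N2 ^ 2 = t2 + tau - r ^ 2.
Hypothesis hU : U1 * U2 = K * (xi ^ 2 - sigma).
Hypothesis hV : V1 * V2 = 2 * s * K * (mu2 - mu1).
Hypothesis hM : M1 * M2 = r * kap * (z1 + z2).
Hypothesis hN : N1 * N2 = r * kap * (z1 - z2).

(** The chosen value of [U1 U2] cancels the last term of [roots_sqr_sum]. The common denominator of
    [alpha] and [beta] thus becomes a multiple of [mu1 mu2]. *)
Lemma U_add_sqr : tau * (U1 + U2) ^ 2 = 4 * K ^ 2 * (mu1 * mu2).
Proof.
  transitivity (tau * (U1 ^ 2 + U2 ^ 2 + 2 * (U1 * U2))); [ring|].
  transitivity (4 * K * (K * (mu1 * mu2))); [|ring].
  rewrite mu_sqr_scaled, hU, hU1, hU2.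
  lincomb (tau ⊙ roots_sqr_sum).
Qed.

Lemma MN_prod : M1 * N1 * M2 * N2 = K * r ^ 2 * (z1 ^ 2 - z2 ^ 2).
Proof.
  transitivity ((M1 * M2) * (N1 * N2)); [ring|].
  rewrite hM, hN, <- hkap. ring.
Qed.

(** Here [z1 ^ 2 - z2 ^ 2 = x2 y1 - x1 y2] is antisymmetric in the indices, and [mu1], [mu2] are
    combinations of [x] and [y], so only the mixed terms survive; the next lemma is the same with
    [y]. *)
Lemma MN_prod_x : tau * (M1 * N1 * M2 * N2) = K * r ^ 2 * (x1 * mu2 - x2 * mu1).
Proof.
  rewrite MN_prod. unfold mu1, mu2.
  lincomb ((- (K * r ^ 2 * tau)) ⊙ m3_xy2 H ⊕ (K * r ^ 2 * tau) ⊙ m3_xy1 H).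
Qed.

Lemma MN_prod_y : M1 * N1 * M2 * N2 = K * (y1 * mu2 - y2 * mu1).
Proof.
  rewrite MN_prod. unfold mu1, mu2.
  lincomb ((- (K * r ^ 2)) ⊙ m3_xy2 H ⊕ (K * r ^ 2) ⊙ m3_xy1 H).
Qed.

Let calA' := ((t1 + tau + r ^ 2) * (t2 + tau + r ^ 2) - 2 * (p ^ 2 + r ^ 2) * r ^ 2) * tau.
Let calB' := ((t1 + tau - r ^ 2) * (t2 + tau - r ^ 2) + 2 * (p ^ 2 - r ^ 2) * r ^ 2) * tau.

Lemma calA_sub : calA' - r ^ 2 * (U1 * U2) =
  K * r ^ 2 * (x1 * mu2 + x2 * mu1 + y1 * mu2 + y2 * mu1).
Proof.
  unfold calA'. rewrite roots_shift_add, hU. unfold mu1, mu2.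
  pose proof (m3_z_sqr_sum H) as A.
  destruct H as [hs hx hz hy h1 h2 _ _ _ _ _ _].
  lincomb ((2 * (p ^ 2 + r ^ 2) * r ^ 2) ⊙ hK ⊕ (K * r ^ 2) ⊙ (1 ⊙ A ⊕ (2 * tau) ⊙ hz
    ⊕ (2 * tau) ⊙ hy ⊕ (- (2 * r ^ 2)) ⊙ hx ⊕ (tau - r ^ 2) ⊙ h1 ⊕ (tau - r ^ 2) ⊙ h2
    ⊕ 1 ⊙ hs)).
Qed.

Lemma calB_add : calB' + r ^ 2 * (U1 * U2) =
  K * r ^ 2 * (x1 * mu2 + x2 * mu1 - y1 * mu2 - y2 * mu1).
Proof.
  unfold calB'. rewrite roots_shift_sub, hU. unfold mu1, mu2.
  pose proof (m3_z_sqr_sum H) as A.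
  destruct H as [hs hx hz hy h1 h2 _ _ _ _ _ _].
  lincomb ((- (2 * (p ^ 2 - r ^ 2) * r ^ 2)) ⊙ hK ⊕ (K * r ^ 2) ⊙ ((-(1)) ⊙ A
    ⊕ (- (2 * tau)) ⊙ hz
    ⊕ (- (2 * tau)) ⊙ hy ⊕ (- (2 * r ^ 2)) ⊙ hx ⊕ (tau + r ^ 2) ⊙ h1 ⊕ (tau + r ^ 2) ⊙ h2
    ⊕ (-(1)) ⊙ hs)).
Qed.

Lemma sqr_MN_add : tau * (M2 * N1 + M1 * N2) ^ 2 = 4 * K * r ^ 2 * x1 * mu2.
Proof.
  transitivity (tau * (M2 ^ 2 * N1 ^ 2 + M1 ^ 2 * N2 ^ 2 + 2 * (M1 * N1 * M2 * N2)));
    [ring|].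
  rewrite MN_prod, hM1, hM2, hN1, hN2.
  (* The two mixed products differ from the two pure ones, in sum, by [4 r ^ 4]. *)
  transitivity (tau * ((t1 + tau + r ^ 2) * (t2 + tau + r ^ 2)
    + (t1 + tau - r ^ 2) * (t2 + tau - r ^ 2) - 4 * r ^ 4
    + 2 * (K * r ^ 2 * (z1 ^ 2 - z2 ^ 2)))); [ring|].
  rewrite roots_shift_add, roots_shift_sub. unfold mu2.
  lincomb ((4 * r ^ 4) ⊙ hK ⊕ (4 * K * r ^ 2 * tau) ⊙ m3_xy1 H
    ⊕ (- (4 * K * r ^ 4)) ⊙ m3_x H).
Qed.

(** Because [V1 ^ 2 + U1 ^ 2 = V2 ^ 2 + U2 ^ 2 = 4 s ^ 2 tau], everything reduces to [U1 U2] and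
    [V1 V2]. The factor [mu1] appears through [4 s ^ 2 tau + U1 U2 - V1 V2 = 4 s K mu1], and
    [m3_mu_add] identifies the cofactor. *)
Lemma sqr_UV_add :
  (U1 * V2 + U2 * V1) ^ 2 = 16 * s ^ 2 * K ^ 2 * mu1 * (2 * s * x2 * w1 ^ 2).
Proof.
  pose proof (m3_mu_add H) as D. fold mu1 mu2 in D.
  transitivity (U1 ^ 2 * V2 ^ 2 + U2 ^ 2 * V1 ^ 2 + 2 * (U1 * U2) * (V1 * V2)); [ring|].
  rewrite hU1, hU2, hV1, hV2, hU, hV, (m3_w1_sqr H). fold mu1.
  transitivity (4 * s ^ 2 * tau * (t1 ^ 2 + t2 ^ 2 - 2 * sigma)
    - 2 * ((t1 ^ 2 - sigma) * (t2 ^ 2 - sigma))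
    + 2 * (K * (xi ^ 2 - sigma)) * (2 * s * K * (mu2 - mu1))); [ring|].
  rewrite roots_sqr_sum, roots_sqr_prod.
  transitivity (16 * s ^ 2 * K * (K * (mu1 * mu2)) - 2 * (K * (xi ^ 2 - sigma)) *
    (4 * s ^ 2 * tau + K * (xi ^ 2 - sigma) - 2 * s * K * (mu2 - mu1))).
  - rewrite mu_sqr_scaled. ring.
  - rewrite det_scaled. lincomb ((8 * s * K ^ 2 * mu1) ⊙ D).
Qed.

(** Serves for [v = tau + r ^ 2] and [v = tau - r ^ 2], where [t1 + v] and [t2 + v] are squares of
    the [M] or of the [N] radicals; these brackets occur in [F1 * F3]. *)
Lemma shifted_V_prod (v : C) :
  ((t2 + v) * V1 - (t1 + v) * V2) * (U1 * V2 + U2 * V1) * (U1 - U2)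
  = - (16 * s * K ^ 2 * xi * (K - 1) * mu1 * (2 * s * mu2 + sigma + v * xi)).
Proof.
  set (P := K * (xi ^ 2 - sigma)).
  set (c := 4 * s ^ 2 * tau).
  transitivity ((V1 * V2 - P) *
      ((t2 + v) * U1 ^ 2 - P * (t1 + t2 + 2 * v) + (t1 + v) * U2 ^ 2)
    + c * (P * (t1 + t2 + 2 * v) - (t1 + v) * U1 ^ 2 - (t2 + v) * U2 ^ 2)).
  { assert (hV1' : V1 ^ 2 = c - U1 ^ 2) by (rewrite hV1, hU1; unfold c; ring).
    assert (hV2' : V2 ^ 2 = c - U2 ^ 2) by (rewrite hV2, hU2; unfold c; ring).
    fold P in hU.
    transitivity ((t2 + v) * (U1 ^ 2 * (V1 * V2) - (U1 * U2) * (V1 * V2)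
      + ((U1 * U2) - U2 ^ 2) * V1 ^ 2)
      - (t1 + v) * ((U1 ^ 2 - U1 * U2) * V2 ^ 2 + (U1 * U2) * (V1 * V2)
       - U2 ^ 2 * (V1 * V2))); [ring|].
    rewrite hV1', hV2'.
    transitivity ((t2 + v) * (U1 ^ 2 * (V1 * V2) - (U1 * U2) * (V1 * V2)
      + c * ((U1 * U2) - U2 ^ 2) - (U1 * U2) * U1 ^ 2 + (U1 * U2) ^ 2)
      - (t1 + v) * (c * (U1 ^ 2 - U1 * U2) - (U1 * U2) ^ 2 + (U1 * U2) * U2 ^ 2
        + (U1 * U2) * (V1 * V2)
       - U2 ^ 2 * (V1 * V2))); [ring|].
    rewrite hU. ring. }
  (* Both symmetric expressions in the roots share the factor [4 K xi (K - 1)]. *)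
  assert (a : (t2 + v) * U1 ^ 2 - P * (t1 + t2 + 2 * v) + (t1 + v) * U2 ^ 2
    = 4 * K * xi * (K - 1) * (sigma + v * xi)).
  { rewrite hU1, hU2.
    transitivity ((t1 + t2) * (t1 * t2 - sigma - P)
      + v * ((t1 + t2) ^ 2 - 2 * (t1 * t2) - 2 * sigma - 2 * P)); [ring|].
    rewrite hsum, hprod. unfold P. ring. }
  assert (b : P * (t1 + t2 + 2 * v) - (t1 + v) * U1 ^ 2 - (t2 + v) * U2 ^ 2
    = 4 * K * xi * (K - 1) * (sigma - 2 * K * xi ^ 2 - v * xi)).
  { rewrite hU1, hU2.
    transitivity ((t1 + t2) * (P + sigma - (t1 + t2) ^ 2 + 3 * (t1 * t2))
      - v * ((t1 + t2) ^ 2 - 2 * (t1 * t2) - 2 * sigma - 2 * P)); [ring|].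
    rewrite hsum, hprod. unfold P. ring. }
  rewrite a, b, hV.
  pose proof det_scaled as D. fold c P in D.
  pose proof mu_sqr_scaled as E.
  unfold c in *.
  lincomb ((- (4 * K * xi * (K - 1) * (sigma + v * xi))) ⊙ D
    ⊕ (32 * s ^ 2 * K * xi * (K - 1)) ⊙ E).
Qed.

(** Put [A = (x1 + y1) mu2] and [B = (x2 + y2) mu1]. Up to a constant the first numerator is [(A +
    B)(mu1 + mu2) - (A - B)(mu2 - mu1) = 2 (A mu1 + B mu2)], and [mu1 mu2] cancels against [D]. The
    others follow by changing signs, with [x - y] in place of [x + y] for [beta]. *)
Lemma alpha_beta_explicit :
  r <> 0 -> s <> 0 -> tau <> 0 -> U1 + U2 <> 0 ->
  let E := 4 * s ^ 2 * tau + U1 * U2 in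
  let D := 4 * r ^ 2 * s * tau * (U1 + U2) ^ 2 in
  ((calA' - r ^ 2 * U1 * U2) * E - (tau + r ^ 2) * M1 * N1 * M2 * N2 * V1 * V2) / D
    = (x1 + x2 + y1 + y2) / 4 /\
  ((calA' - r ^ 2 * U1 * U2) * V1 * V2 - E * (tau + r ^ 2) * M1 * N1 * M2 * N2) / D
    = - ((x1 - x2 + y1 - y2) / 4) /\
  ((calB' + r ^ 2 * U1 * U2) * V1 * V2 - E * (tau - r ^ 2) * M1 * N1 * M2 * N2) / D
    = - ((x1 - x2 - y1 + y2) / 4) /\
  ((calB' + r ^ 2 * U1 * U2) * E - (tau - r ^ 2) * M1 * N1 * M2 * N2 * V1 * V2) / D
    = (x1 + x2 - y1 - y2) / 4.
Proof.
  intros hr hs ht hUn E D.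
  assert (hE : E = 2 * s * K * (mu1 + mu2)).
  { unfold E. rewrite hU. apply det_scaled. }
  assert (hD : D = 16 * r ^ 2 * s * K ^ 2 * (mu1 * mu2)).
  { unfold D. transitivity (4 * r ^ 2 * s * (tau * (U1 + U2) ^ 2)); [ring|].
    rewrite U_add_sqr. ring. }
  assert (hDn : D <> 0).
  { unfold D. nonzero. }
  assert (Tp : (tau + r ^ 2) * (M1 * N1 * M2 * N2) =
     K * r ^ 2 * (x1 * mu2 - x2 * mu1 + y1 * mu2 - y2 * mu1)).
  { lincomb (1 ⊙ MN_prod_x ⊕ r ^ 2 ⊙ MN_prod_y). }
  assert (Tm : (tau - r ^ 2) * (M1 * N1 * M2 * N2) =
     K * r ^ 2 * (x1 * mu2 - x2 * mu1 - y1 * mu2 + y2 * mu1)).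
  { lincomb (1 ⊙ MN_prod_x ⊕ (- r ^ 2) ⊙ MN_prod_y). }
  repeat split; symmetry; apply Cdiv_intro; auto; rewrite hD.
  - transitivity ((calA' - r ^ 2 * (U1 * U2)) * E
      - ((tau + r ^ 2) * (M1 * N1 * M2 * N2)) * (V1 * V2)); [|ring].
    rewrite calA_sub, Tp, hV, hE. field.
  - transitivity ((calA' - r ^ 2 * (U1 * U2)) * (V1 * V2)
      - E * ((tau + r ^ 2) * (M1 * N1 * M2 * N2))); [|ring].
    rewrite calA_sub, Tp, hV, hE. field.
  - transitivity ((calB' + r ^ 2 * (U1 * U2)) * (V1 * V2)
      - E * ((tau - r ^ 2) * (M1 * N1 * M2 * N2))); [|ring].
    rewrite calB_add, Tm, hV, hE. field.
  - transitivity ((calB' + r ^ 2 * (U1 * U2)) * E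
      - ((tau - r ^ 2) * (M1 * N1 * M2 * N2)) * (V1 * V2)); [|ring].
    rewrite calB_add, Tm, hV, hE. field.
Qed.

(** * The formulas for [omega] *)

Variables x mu k2 q Q : C.
Hypothesis hx2 : x ^ 2 = X.
Hypothesis hmu2 : mu ^ 2 = mu1 * mu2.
Hypothesis hdt : tau * (t1 ^ 2 - t2 ^ 2) = 4 * K ^ 2 * xi * mu * x.
Hypothesis hk2 : k2 ^ 2 = 2.
Hypothesis hq : q ^ 2 = s * tau.
Hypothesis hQ : Q = k2 * xi * kap.
Hypothesis hr0 : r <> 0.
Hypothesis hs0 : s <> 0.
Hypothesis htau0 : tau <> 0.
Hypothesis hdt0 : t1 ^ 2 - t2 ^ 2 <> 0.

Let dt := t1 ^ 2 - t2 ^ 2.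
(** The values that the claimed formulas give to [w1], [w2], [w3]: in [omega1 + i omega2] and
    [omega1 - i omega2] the sums of radicals factor. *)
Let F1 := Q / (4 * r * s * q) * ((M2 * N1 + M1 * N2) * (U1 * V2 + U2 * V1) / dt).
Let F2 := Q / (4 * r * s * q) * ((M2 * N1 - M1 * N2) * (U1 * V2 - U2 * V1) / dt).
Let F3 := (U1 - U2) / (k2 * q) * ((M2 * N2 * V1 - M1 * N1 * V2) / dt).

Lemma k2_neq0 : k2 <> 0.
Proof.
  intros E. rewrite E in hk2. apply (@RtoC_neq 2 0); [lra|]. rewrite <- hk2. ring.
Qed.

Lemma q_neq0 : q <> 0.
Proof.
  intros E. apply (Cmult_neq_0 s tau); auto. rewrite <- hq, E. ring.
Qed.

Lemma Q_sqr : Q ^ 2 = 2 * xi ^ 2 * K.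
Proof.
  rewrite hQ, <- hkap, <- hk2. ring.
Qed.

Lemma K_xi_mu_x_neq0 : 4 * K ^ 2 * xi * mu * x <> 0.
Proof.
  rewrite <- hdt. now apply Cmult_neq_0.
Qed.

(** The squares of the two sums contribute [x1 mu2] and [mu1 x2]; their product is [(x mu) ^ 2],
    which cancels against [dt ^ 2]. *)
Lemma F1_sqr : F1 ^ 2 = w1 ^ 2.
Proof.
  apply (@Cmult_cancel_l (16 * r ^ 2 * s ^ 2 * q ^ 2 * (tau * dt) ^ 2)).
  { pose proof q_neq0. nonzero. }
  transitivity (Q ^ 2 * tau * (tau * (M2 * N1 + M1 * N2) ^ 2) * (U1 * V2 + U2 * V1) ^ 2).
  { unfold F1. field. auto using q_neq0. }
  rewrite Q_sqr, sqr_MN_add, sqr_UV_add, hq. unfold dt. rewrite hdt.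
  transitivity (256 * K ^ 4 * xi ^ 2 * tau * r ^ 2 * s ^ 3 * w1 ^ 2 * (x1 * x2) * (mu1 * mu2));
    [ring|].
  rewrite <- hmu2, (m3_x H), <- hx2. ring.
Qed.

Lemma F1_F2 : F1 * F2 = w1 * w2.
Proof.
  apply (@Cmult_cancel_l (16 * r ^ 2 * s ^ 2 * q ^ 2 * dt ^ 2 * (t1 + t2))).
  { pose proof q_neq0. nonzero. intros E. apply hdt0. transitivity ((t1 - t2) * (t1 + t2)); [ring|].
      rewrite E; ring. }
  transitivity (Q ^ 2 * (M2 ^ 2 * N1 ^ 2 - M1 ^ 2 * N2 ^ 2)
    * (U1 ^ 2 * V2 ^ 2 - U2 ^ 2 * V1 ^ 2) * (t1 + t2)).
  { unfold F1, F2. field. auto using q_neq0. }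
  rewrite hM1, hM2, hN1, hN2, hU1, hU2, hV1, hV2, Q_sqr, hq.
  transitivity (16 * xi ^ 2 * K * r ^ 2 * s ^ 2 * tau * dt ^ 2); [unfold dt; ring|].
  rewrite hsum, <- (m3_w H). ring.
Qed.

Lemma F1_F3 : F1 * F3 = w1 * w3.
Proof.
  (* [mu2] is cancelled below; if it vanished, so would [mu], and with it [dt]. *)
  assert (hm2 : mu2 <> 0).
  { intros E. apply K_xi_mu_x_neq0.
    destruct (@Csqr_eq mu 0) as [E'|E'].
    - rewrite hmu2, E. ring.
    - rewrite E'; ring.
    - rewrite E'; ring. }
  apply (@Cmult_cancel_l (4 * r * s * q ^ 2 * (tau * dt) ^ 2 * s * mu2)).
  { pose proof q_neq0. nonzero. }
  (* Multiplying out the sums in [M] and [N] leaves squares and the prescribed products [M1 M2],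
     [N1 N2]; each bracket is an instance of [shifted_V_prod]. *)
  transitivity (tau ^ 2 * s * mu2 * (Q / k2) * (
     N1 * N2 * (((M2 ^ 2) * V1 - (M1 ^ 2) * V2) * (U1 * V2 + U2 * V1) * (U1 - U2))
     + M1 * M2 * (((N2 ^ 2) * V1 - (N1 ^ 2) * V2) * (U1 * V2 + U2 * V1) * (U1 - U2)))).
  { unfold F1, F3. field. auto using q_neq0, k2_neq0. }
  assert (hQ' : Q / k2 = xi * kap) by (rewrite hQ; field; apply k2_neq0).
  rewrite hQ', hM1, hM2, hN1, hN2.
  pose proof (shifted_V_prod (tau + r ^ 2)) as A.
  pose proof (shifted_V_prod (tau - r ^ 2)) as B.
  replace (t1 + tau + r ^ 2) with (t1 + (tau + r ^ 2)) by ring.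
  replace (t2 + tau + r ^ 2) with (t2 + (tau + r ^ 2)) by ring.
  replace (t1 + tau - r ^ 2) with (t1 + (tau - r ^ 2)) by ring.
  replace (t2 + tau - r ^ 2) with (t2 + (tau - r ^ 2)) by ring.
  rewrite A, B, hM, hN. unfold dt. rewrite hdt, hq.
  assert (C1 : mu2 * (2 * s * w1 * w3)
      = r ^ 2 * xi * z2 - z1 * (sigma + tau * xi) - 2 * s * mu2 * z1).
  { rewrite (m3_w1_w3 H). unfold mu2.
    destruct H as [hs hx hz hy h1 h2 _ _ _ _ _ _].
    lincomb ((r ^ 2 * z2) ⊙ hx ⊕ (- (r ^ 2 * z1)) ⊙ h2 ⊕ (- (tau * z2)) ⊙ h1
      ⊕ (tau * z1) ⊙ hy ⊕ (r ^ 2 * z2 + tau * z1) ⊙ hz ⊕ z1 ⊙ hs). }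
  transitivity (32 * (tau * (K - 1)) * s ^ 2 * tau * r * mu2 * (kap ^ 2 * K ^ 2) * xi ^ 2 * mu1
    * (r ^ 2 * xi * z2 - z1 * (sigma + tau * xi) - 2 * s * mu2 * z1)); [ring|].
  rewrite <- C1, hkap.
  replace (tau * (K - 1)) with (K * x ^ 2) by (rewrite hx2; lincomb ((-(1)) ⊙ hK)).
  transitivity (64 * r * s ^ 3 * tau * K ^ 4 * xi ^ 2 * (mu1 * mu2) * x ^ 2 * mu2 * (w1 * w3));
    [ring|].
  rewrite <- hmu2. ring.
Qed.

End Explicit.

(** * Algebra of the separated equation at a single root [t] *)

Section Separation.

Variables p r s tau sigma X xi x1 x2 y1 y2 z1 z2 w1 w2 w3 t : C.
Hypothesis H : m3_point p r s tau sigma X xi x1 x2 y1 y2 z1 z2 w1 w2 w3.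
Hypothesis ht : (tau - X) * t ^ 2 - 2 * tau * xi * t + tau * xi ^ 2 + sigma * X = 0.

Let mu1 := r ^ 2 * x1 - tau * y1.
Let mu2 := r ^ 2 * x2 - tau * y2.

Lemma root_z_sqr_sum :
  tau * (r ^ 2 * (z1 ^ 2 + z2 ^ 2))
  = 2 * (t + tau) * tau * (z1 * z2) - ((t + tau) ^ 2 - r ^ 4) * (tau - X).
Proof.
  pose proof (m3_z_sqr_sum H) as A.
  destruct H as [hs hx hz hy h1 h2 _ _ _ _ _ _].
  lincomb (1 ⊙ ht ⊕ tau ⊙ A ⊕ (- (2 * (t + tau) * tau)) ⊙ hz ⊕ (- X) ⊙ hs).
Qed.

(** With [u = (t + tau) ^ 2 - r ^ 4] the square is [u z1 ^ 2 + r ^ 2 (r ^ 2 (z1 ^ 2 + z2 ^ 2) - 2 (t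
    + tau) z1 z2)]. After scaling by [tau], [root_z_sqr_sum] extracts [u] from the second term
    too. *)
Lemma root_G_sqr :
  tau * ((t + tau) * z1 - r ^ 2 * z2) ^ 2 = ((t + tau) ^ 2 - r ^ 4) * (x1 * mu2).
Proof.
  pose proof root_z_sqr_sum as A. unfold mu2.
  destruct H as [hs hx hz hy h1 h2 _ _ _ _ _ _].
  lincomb (r ^ 2 ⊙ A ⊕ (((t + tau) ^ 2 - r ^ 4) * tau) ⊙ h1
    ⊕ (- (((t + tau) ^ 2 - r ^ 4) * r ^ 2)) ⊙ hx).
Qed.

Lemma root_G_mul :
  tau * (((t + tau) * z1 - r ^ 2 * z2) * ((t + tau) * z2 - r ^ 2 * z1))
  = ((t + tau) ^ 2 - r ^ 4) * (t * (tau - X) - tau * xi).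
Proof.
  pose proof root_z_sqr_sum as A.
  destruct H as [hs hx hz hy h1 h2 _ _ _ _ _ _].
  lincomb ((- (t + tau)) ⊙ A ⊕ (- (tau * ((t + tau) ^ 2 - r ^ 4))) ⊙ hz).
Qed.

End Separation.

(* [dX] and [dxi2] are the values of [dX/dt] and [2 dxi/dt] on a solution. *)
Lemma separated_velocity_sqr p r s tau sigma X xi x1 x2 y1 y2 z1 z2 w1 w2 w3 t dX dxi2 :
  m3_point p r s tau sigma X xi x1 x2 y1 y2 z1 z2 w1 w2 w3 ->
  (tau - X) * t ^ 2 - 2 * tau * xi * t + tau * xi ^ 2 + sigma * X = 0 ->
  X <> 0 ->
  dX = Ci * (x2 * z1 * w1 - x1 * z2 * w2) ->
  dxi2 = Ci * (x2 * z1 * w1 - x1 * z2 * w2 - y2 * z2 * w1 + y1 * z1 * w2) ->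
  2 * s * tau * (tau * (t - xi) * dxi2 + (t ^ 2 - sigma) * dX) ^ 2
  = (tau - X) ^ 2 * (sigma + 4 * s ^ 2 * tau - t ^ 2) * (t ^ 2 - sigma)
    * (r ^ 4 - (t + tau) ^ 2).
Proof.
  intros H ht hX hdX hdxi.
  pose proof (m3_point_swap H) as H'.
  pose proof (root_G_sqr H ht) as G11.
  pose proof (root_G_sqr H' ht) as G22.
  pose proof (root_G_mul H ht) as G12.
  pose proof (m3_w1_sqr H) as W1.
  pose proof (m3_w1_sqr H') as W2.
  pose proof (m3_w H) as W.
  pose proof (m3_mu_add H) as D.
  pose proof (m3_mu_mul H) as M.
  set (mu1 := r ^ 2 * x1 - tau * y1) in *.
  set (mu2 := r ^ 2 * x2 - tau * y2) in *.
  set (G1 := (t + tau) * z1 - r ^ 2 * z2) in *.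
  set (G2 := (t + tau) * z2 - r ^ 2 * z1) in *.
  set (u := (t + tau) ^ 2 - r ^ 4) in *.
  (* The quadratic equation regrouped around the square of [t - xi]. *)
  assert (hU : X * (t ^ 2 - sigma) = tau * (t - xi) ^ 2) by lincomb ((-(1)) ⊙ ht).
  assert (hI : Ci ^ 2 = - (1)) by apply Ci_sqr.
  (* Scaling by [X] lets [hU] bring out [tau (t - xi)] from both terms; what remains is linear in
     [G1] and [G2]. *)
  assert (hL : X * (tau * (t - xi) * dxi2 + (t ^ 2 - sigma) * dX)
    = Ci * (tau * (t - xi) * (x2 * w1 * G1 - x1 * w2 * G2))).
  { transitivity (tau * (t - xi) * (X * dxi2 + (t - xi) * dX)).
    - lincomb (dX ⊙ hU).
    - rewrite hdX, hdxi. unfold G1, G2.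
      destruct H as [hs hx hz hy h1 h2 _ _ _ _ _ _].
      lincomb ((tau * (t - xi) * Ci) ⊙
        ((y2 * z2 * w1 - y1 * z1 * w2) ⊙ hx
         ⊕ (- (x2 * z2 * w1)) ⊙ h1 ⊕ (x1 * z1 * w2) ⊙ h2
         ⊕ (x2 * z1 * w1 - x1 * z2 * w2) ⊙ hz)). }
  assert (hB : tau * (2 * s * (tau - X) * (mu1 + mu2) - 2 * (mu1 * mu2)
      - 2 * xi * (t * (tau - X) - tau * xi))
    = (tau - X) ^ 2 * (sigma + 4 * s ^ 2 * tau - t ^ 2)).
  { rewrite M. lincomb ((tau * (tau - X)) ⊙ D ⊕ (tau - X) ⊙ ht). }
  apply (@Cmult_cancel_l (X ^ 2)); [nonzero|].
  transitivity (2 * s * tau * (X * (tau * (t - xi) * dxi2 + (t ^ 2 - sigma) * dX)) ^ 2);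
    [ring|].
  rewrite hL.
  (* Squaring pairs [w1 ^ 2], [w2 ^ 2], [w1 w2] with [G1 ^ 2], [G2 ^ 2], [G1 G2], all of them
     known. *)
  transitivity (tau ^ 2 * (t - xi) ^ 2 * Ci ^ 2 *
    (x2 * (2 * s * x2 * w1 ^ 2) * (tau * G1 ^ 2) + x1 * (2 * s * x1 * w2 ^ 2) * (tau * G2 ^ 2)
      - 2 * (x1 * x2) * (2 * s * w1 * w2) * (tau * (G1 * G2)))); [ring|].
  rewrite W1, W2, W, G11, G22, G12, hI.
  transitivity (- (X * u * (tau * (t - xi) ^ 2) * (tau * (2 * s * (tau - X) * (mu1 + mu2)
     - 2 * (mu1 * mu2) - 2 * xi * (t * (tau - X) - tau * xi))))).
  - rewrite <- (m3_x H). ring.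
  - rewrite <- hU, hB. unfold u. ring.
Qed.

(** * From the defining relations and integrals to the linear system *)

Lemma m3_point_of_in_M3 (a b p r s tau sigma X : R) (q : point) :
  (p ^ 2 = a ^ 2 + b ^ 2)%R -> (r ^ 2 = a ^ 2 - b ^ 2)%R ->
  (sigma = tau ^ 2 - 2 * p ^ 2 * tau + r ^ 4)%R ->
  in_M3 a b q -> integralS q = RtoC s -> integralT q = RtoC tau ->
  RtoC X = x1 q * x2 q ->
  m3_point (RtoC p) (RtoC r) (RtoC s) (RtoC tau) (RtoC sigma) (RtoC X) (RtoC (xi tau q))
    (x1 q) (x2 q) (y1 q) (y2 q) (z1 q) (z2 q) (w1 q) (w2 q) (w3 q).
Proof.
  intros hp hr hs [[ha [hb hab]] [hw [hF1 hF2]]] hS hT hX.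
  assert (hsig : RtoC sigma = RtoC tau ^ 2 - 2 * RtoC p ^ 2 * RtoC tau + RtoC r ^ 4).
  { rewrite hs. rewrite !RtoC_plus, !RtoC_minus, !RtoC_mult, !RtoC_pow. reflexivity. }
  assert (hxi : RtoC (xi tau q) = x1 q * x2 q + z1 q * z2 q - RtoC tau).
  { unfold xi. apply injective_projections; simpl; ring. }
  assert (hz : z1 q * z2 q = RtoC (xi tau q) + RtoC tau - RtoC X).
  { rewrite hxi, hX. ring. }
  assert (hy0 : x1 q * x2 q + y1 q * y2 q + 2 * (z1 q * z2 q) = 2 * RtoC p ^ 2).
  { rewrite <- RtoC_pow, hp. unfold dot3 in *.
    apply injective_projections; simpl in *; lra. }
  assert (hy : y1 q * y2 q = 2 * RtoC p ^ 2 + RtoC X - 2 * RtoC (xi tau q) - 2 * RtoC tau).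
  { rewrite hxi, hX, <- hy0. ring. }
  (* The real and imaginary parts of [(alpha + i beta) . (alpha + i beta) = a ^ 2 - b ^ 2], whose
     first two terms factor as [x1 y2]; [h2] is the conjugate. *)
  assert (h1 : x1 q * y2 q = RtoC r ^ 2 - z1 q ^ 2).
  { rewrite <- RtoC_pow, hr. unfold dot3 in *.
    apply injective_projections; simpl in *; lra. }
  assert (h2 : x2 q * y1 q = RtoC r ^ 2 - z2 q ^ 2).
  { rewrite <- RtoC_pow, hr. unfold dot3 in *.
    apply injective_projections; simpl in *; lra. }
  assert (hw1 : w1 q <> 0) by (intros E; apply hw; rewrite E; ring).
  assert (hw2 : w2 q <> 0) by (intros E; apply hw; rewrite E; ring).
  unfold integralS in hS. unfold integralT in hT. cbv zeta in hF1, hF2.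
  revert hw1 hw2 hF1 hF2 hS hT hX hxi hz hy h1 h2.
  generalize (RtoC (xi tau q)) (x1 q) (x2 q) (y1 q) (y2 q) (z1 q) (z2 q)
    (w1 q) (w2 q) (w3 q).
  intros cxi x1 x2 y1 y2 z1 z2 w1 w2 w3 hw1 hw2 hF1 hF2 hS hT hX hxi hz hy h1 h2.
  (* [hF1] equates two fractions whose sum is [- 4 s] by [hS], so each is [- 2 s]. *)
  assert (R1 : (y2 + 2 * s) * w1 + x1 * w2 + z1 * w3 = 0).
  { apply (Ceq_shift ((w1 / 2) ⊙ hF1 ⊕ (- (2 * w1)) ⊙ hS)).
    rewrite RtoC_div by lra. field. auto. }
  assert (R2 : x2 * w1 + (y1 + 2 * s) * w2 + z2 * w3 = 0).
  { apply (Ceq_shift ((- w2 / 2) ⊙ hF1 ⊕ (- (2 * w2)) ⊙ hS)).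
    rewrite RtoC_div by lra. field. auto. }
  assert (W : 2 * s * w1 * w2 = cxi).
  { rewrite hxi, <- hT. rewrite RtoC_div by lra.
    apply (Ceq_shift ((w2 / 2) ⊙ R1 ⊕ (w1 / 2) ⊙ R2)). field. }
  constructor; auto.
  (* Only [m3_row3] is left; it is the second relation [hF2] reduced by the two rows, [W] and
     [hz]. *)
  apply (@Cmult_cancel_l (2 * w1 * w2)); [nonzero|].
  apply (Ceq_shift ((w1 * w2) ⊙ hF2 ⊕ (- (w1 * w2 ^ 2 * w3 - w2 * (w1 * z2 - w2 * z1))) ⊙ R1
    ⊕ (- (w1 ^ 2 * w2 * w3 + w1 * (w1 * z2 - w2 * z1))) ⊙ R2
    ⊕ (2 * w1 * w2 * w3) ⊙ W ⊕ (- (2 * w1 * w2 * w3)) ⊙ hz)).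
  field. auto.
Qed.

(** * Derivatives along a solution and the two real roots *)

Local Open Scope R_scope.

Lemma in_ivl_locally (lo hi : Rbar) (t : R) :
  in_ivl lo hi t -> locally t (in_ivl lo hi).
Proof.
  intros [h1 h2]. apply filter_and.
  - destruct lo as [l| |]; simpl in *; try easy.
    + now apply open_gt.
    + now apply filter_forall.
  - destruct hi as [l| |]; simpl in *; try easy.
    + now apply open_lt.
    + now apply filter_forall.
Qed.

(** Continuity fixes the sign of [f] near [t], so there [f] is one of the two smooth branches of the
    root of [g]. *)
Lemma is_derive_continuous_sqrt (f g : R -> R) (t g' : R) :
  continuous f t -> f t <> 0 -> locally t (fun u => f u ^ 2 = g u) ->
  is_derive g t g' -> is_derive f t (g' / (2 * f t)).
Proof.
  intros hc h0 hl hg.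
  pose proof (locally_singleton _ _ hl) as ht; simpl in ht.
  assert (hgt : 0 < g t) by (rewrite <- ht; nra).
  destruct (Rlt_le_dec 0 (f t)) as [h|h].
  - pose proof (hc (fun y => 0 < y) (open_gt 0 (f t) h)) as hp.
    apply is_derive_ext_loc with (fun u => sqrt (g u)).
    + generalize (filter_and _ _ hl hp). apply filter_imp.
      intros u [hu hu']. rewrite <- hu. apply sqrt_pow2. lra.
    + replace (f t) with (sqrt (g t)) by (rewrite <- ht; apply sqrt_pow2; lra).
      now apply is_derive_sqrt.
  - assert (h' : f t < 0) by lra.
    pose proof (hc (fun y => y < 0) (open_lt 0 (f t) h')) as hp.
    apply is_derive_ext_loc with (fun u => - sqrt (g u)).
    + generalize (filter_and _ _ hl hp). apply filter_imp.
      intros u [hu hu']. rewrite <- hu. replace (f u ^ 2) with ((- f u) ^ 2) by ring.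
      rewrite sqrt_pow2; lra.
    + assert (E : sqrt (g t) = - f t).
      { rewrite <- ht. rewrite <- (sqrt_pow2 (- f t)) by lra. f_equal; ring. }
      replace (f t) with (- sqrt (g t)) by (rewrite E; ring).
      replace (g' / (2 * - sqrt (g t))) with (- (g' / (2 * sqrt (g t)))).
      2:{ field. apply Rgt_not_eq, sqrt_lt_R0, hgt. }
      apply (is_derive_opp (V := R_NormedModule)). now apply is_derive_sqrt.
Qed.

Lemma is_derive_sqr (f : R -> R) (t l : R) :
  is_derive f t l -> is_derive (fun u => f u ^ 2) t (2 * f t * l).
Proof.
  intros h. replace (2 * f t * l) with (INR 2 * l * f t ^ pred 2) by (simpl; ring).
  now apply is_derive_pow.
Qed.

Definition x1_norm_sqr (q : point) : R :=
  (c1 (alpha q) - c2 (beta q)) ^ 2 + (c2 (alpha q) + c1 (beta q)) ^ 2.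

Lemma x1_norm_sqrE (q : point) : (x1 q * x2 q)%C = RtoC (x1_norm_sqr q).
Proof. unfold x1_norm_sqr. apply injective_projections; simpl; ring. Qed.

Lemma is_derive_x1_norm_sqr (q : R -> point) (t : R) :
  top_equations q t ->
  exists dX : R, is_derive (fun u => x1_norm_sqr (q u)) t dX /\
    RtoC dX = (Ci * (x2 (q t) * z1 (q t) * w1 (q t) - x1 (q t) * z2 (q t) * w2 (q t)))%C.
Proof.
  intros [_ [[a1 [a2 a3]] [b1 [b2 b3]]]].
  eexists; split.
  - unfold x1_norm_sqr.
    apply (is_derive_plus (V := R_NormedModule)); apply is_derive_sqr.
    + apply (is_derive_minus (V := R_NormedModule)); [exact a1|exact b2].
    + apply (is_derive_plus (V := R_NormedModule)); [exact a2|exact b1].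
  - unfold minus, plus, opp; simpl.
    apply injective_projections; simpl; ring.
Qed.

Lemma is_derive_xi (tau : R) (q : R -> point) (t : R) :
  top_equations q t ->
  exists dxi : R, is_derive (fun u => xi tau (q u)) t dxi /\
    RtoC (2 * dxi) = (Ci * (x2 (q t) * z1 (q t) * w1 (q t) - x1 (q t) * z2 (q t) * w2 (q t)
      - y2 (q t) * z2 (q t) * w1 (q t) + y1 (q t) * z1 (q t) * w2 (q t)))%C.
Proof.
  intros Ht.
  destruct (is_derive_x1_norm_sqr Ht) as [dX [hX _]].
  destruct Ht as [_ [[a1 [a2 a3]] [b1 [b2 b3]]]].
  eexists; split.
  - apply is_derive_ext with (fun u => (x1_norm_sqr (q u)
      + (c3 (alpha (q u)) ^ 2 + c3 (beta (q u)) ^ 2)) + (- tau)).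
    { intros u. unfold xi, x1_norm_sqr. simpl. ring. }
    apply (is_derive_plus (V := R_NormedModule)); [|apply (is_derive_const (V := R_NormedModule))].
    apply (is_derive_plus (V := R_NormedModule)).
    + unfold x1_norm_sqr.
      apply (is_derive_plus (V := R_NormedModule)); apply is_derive_sqr.
      * apply (is_derive_minus (V := R_NormedModule)); [exact a1|exact b2].
      * apply (is_derive_plus (V := R_NormedModule)); [exact a2|exact b1].
    + apply (is_derive_plus (V := R_NormedModule)); apply is_derive_sqr; [exact a3|exact b3].
  - unfold minus, plus, opp, zero; simpl.
    apply injective_projections; simpl; ring.
Qed.

(** The opposite choice of [mu] exchanges the two roots, so it suffices to differentiate
    [t_plus]. *)
Lemma t_minus_opp (tau x xi mu : R) : t_minus tau x xi mu = t_plus tau x xi (- mu).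
Proof. unfold t_minus, t_plus. f_equal. ring. Qed.

Lemma t_plus_opp (tau x xi mu : R) : t_plus tau x xi mu = t_minus tau x xi (- mu).
Proof. unfold t_minus, t_plus. f_equal. ring. Qed.

(** The relation is the implicit derivative of the quadratic equation, whose slope at the first root
    is [(tau - x ^ 2)(t1 - t2)]. *)
Lemma is_derive_t_plus (tau sigma : R) (x xi mu : R -> R) (t dX dxi : R) :
  x t <> 0 -> mu t <> 0 -> tau - x t ^ 2 <> 0 ->
  mu t ^ 2 = mu_sq tau sigma (x t) (xi t) ->
  is_derive x t (dX / (2 * x t)) -> is_derive xi t dxi ->
  is_derive mu t ((2 * tau * xi t * dxi + sigma * dX) / (2 * mu t)) ->
  exists d : R, is_derive (fun u => t_plus tau (x u) (xi u) (mu u)) t d /\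
    (tau - x t ^ 2) * ((t_plus tau (x t) (xi t) (mu t) - t_minus tau (x t) (xi t) (mu t)) * d)
    = 2 * tau * (t_plus tau (x t) (xi t) (mu t) - xi t) * dxi
      + (t_plus tau (x t) (xi t) (mu t) ^ 2 - sigma) * dX.
Proof.
  intros hx hm hd hmu Dx Dxi Dmu.
  eexists; split.
  - unfold t_plus.
    apply is_derive_div; [| |exact hd].
    + apply (is_derive_plus (V := R_NormedModule)).
      * apply is_derive_scal; exact Dxi.
      * apply (is_derive_mult (K := R_AbsRing)); [exact Dmu|exact Dx|intros; apply Rmult_comm].
    + apply (is_derive_minus (V := R_NormedModule)); [apply (is_derive_const (V := R_NormedModule))|].
      apply is_derive_sqr; exact Dx.
  - unfold minus, plus, opp, zero, scal, mult; simpl; unfold mult; simpl.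
    unfold t_plus, t_minus, mu_sq in *.
    assert (hmu' : sigma * (tau - x t ^ 2) = tau * xi t ^ 2 - mu t ^ 2) by (rewrite hmu; ring).
    apply (Rmult_eq_reg_r ((tau - x t ^ 2) ^ 2)); [|now apply pow_nonzero].
    match goal with |- ?a = ?b => apply (Rminus_diag_uniq a b) end.
    transitivity (tau * (sigma * (tau - x t ^ 2) - (tau * xi t ^ 2 - mu t ^ 2)) * dX).
    + field. auto.
    + rewrite hmu'. ring.
Qed.

Lemma roots_iff (tau sigma x xi mu u : R) :
  tau - x ^ 2 <> 0 -> mu ^ 2 = mu_sq tau sigma x xi ->
  (tau - x ^ 2) * u ^ 2 - 2 * tau * xi * u + tau * xi ^ 2 + sigma * x ^ 2 = 0
  <-> u = t_plus tau x xi mu \/ u = t_minus tau x xi mu.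
Proof.
  intros hd hmu.
  assert (E : (tau - x ^ 2) * ((tau - x ^ 2) * u ^ 2 - 2 * tau * xi * u
      + tau * xi ^ 2 + sigma * x ^ 2)
    = ((tau - x ^ 2) * (u - t_plus tau x xi mu)) * ((tau - x ^ 2) * (u - t_minus tau x xi mu))).
  { unfold t_plus, t_minus, mu_sq in *.
    transitivity (((tau - x ^ 2) * u - tau * xi) ^ 2 - x ^ 2 * mu ^ 2).
    - rewrite hmu. ring.
    - field. auto. }
  split.
  - intros h. rewrite h, Rmult_0_r in E. symmetry in E.
    destruct (Rmult_integral _ _ E) as [h'|h'];
      destruct (Rmult_integral _ _ h') as [h''|h'']; try contradiction; [left|right]; lra.
  - intros h. apply (Rmult_eq_reg_l (tau - x ^ 2)); [|exact hd].
    rewrite E. destruct h as [-> | ->]; ring.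
Qed.

Lemma t_plus_sqr_diff (tau x xi mu : R) :
  tau - x ^ 2 <> 0 ->
  t_plus tau x xi mu ^ 2 - t_minus tau x xi mu ^ 2 = 4 * tau * xi * mu * x / (tau - x ^ 2) ^ 2.
Proof. intros hd. unfold t_plus, t_minus. field. exact hd. Qed.

(** * Choice of the radicals at a real point *)

Ltac push_RtoC :=
  repeat first [rewrite RtoC_plus | rewrite RtoC_minus | rewrite RtoC_mult | rewrite RtoC_pow].

Lemma explicit_solution_exists (p r s tau sigma x mu : R) (q : point) :
  m3_point (RtoC p) (RtoC r) (RtoC s) (RtoC tau) (RtoC sigma) (RtoC (x ^ 2)) (RtoC (xi tau q))
    (x1 q) (x2 q) (y1 q) (y2 q) (z1 q) (z2 q) (w1 q) (w2 q) (w3 q) ->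
  r <> 0 -> s <> 0 -> tau <> 0 -> tau - x ^ 2 <> 0 ->
  mu ^ 2 = mu_sq tau sigma x (xi tau q) ->
  let t1 := t_plus tau x (xi tau q) mu in
  let t2 := t_minus tau x (xi tau q) mu in
  t1 ^ 2 - t2 ^ 2 <> 0 ->
  exists sqst U1 U2 V1 V2 M1 M2 N1 N2 Q : C,
    (sqst ^ 2)%C = RtoC (s * tau) /\
    (U1 ^ 2)%C = RtoC (t1 ^ 2 - sigma) /\
    (U2 ^ 2)%C = RtoC (t2 ^ 2 - sigma) /\
    (V1 ^ 2)%C = RtoC (sigma + 4 * s ^ 2 * tau - t1 ^ 2) /\
    (V2 ^ 2)%C = RtoC (sigma + 4 * s ^ 2 * tau - t2 ^ 2) /\
    (M1 ^ 2)%C = RtoC (t1 + tau + r ^ 2) /\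
    (M2 ^ 2)%C = RtoC (t2 + tau + r ^ 2) /\
    (N1 ^ 2)%C = RtoC (t1 + tau - r ^ 2) /\
    (N2 ^ 2)%C = RtoC (t2 + tau - r ^ 2) /\
    (Q ^ 2)%C = (RtoC (t1 * t2 + sigma) + U1 * U2)%C /\
    explicit_solution p r s tau t1 t2 sqst U1 U2 V1 V2 M1 M2 N1 N2 Q q.
Proof.
  intros H hr hs ht hd hmu t1 t2 hdt.
  set (K := tau / (tau - x ^ 2)).
  assert (hK : (RtoC K * (RtoC tau - RtoC (x ^ 2)))%C = RtoC tau).
  { rewrite <- RtoC_minus, <- RtoC_mult. f_equal. unfold K. field. exact hd. }
  assert (hsum : (RtoC t1 + RtoC t2)%C = (2 * RtoC K * RtoC (xi tau q))%C).
  { rewrite <- RtoC_plus, <- !RtoC_mult. f_equal. unfold t1, t2, t_plus, t_minus, K.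
    field. exact hd. }
  assert (hprod : (RtoC t1 * RtoC t2)%C
    = (RtoC K * (RtoC (xi tau q) ^ 2 + RtoC sigma) - RtoC sigma)%C).
  { rewrite <- RtoC_pow, <- RtoC_plus, <- !RtoC_mult, <- RtoC_minus. f_equal.
    unfold t1, t2, t_plus, t_minus, K.
    transitivity ((tau ^ 2 * xi tau q ^ 2 - mu ^ 2 * x ^ 2) / (tau - x ^ 2) ^ 2).
    - field. exact hd.
    - rewrite hmu. unfold mu_sq. field. exact hd. }
  assert (hmu2 : (RtoC mu ^ 2)%C = ((RtoC r ^ 2 * x1 q - RtoC tau * y1 q)
      * (RtoC r ^ 2 * x2 q - RtoC tau * y2 q))%C).
  { rewrite (m3_mu_mul H), <- RtoC_pow, hmu. unfold mu_sq. push_RtoC. ring. }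
  assert (hdtC : (RtoC tau * (RtoC t1 ^ 2 - RtoC t2 ^ 2))%C
    = (4 * RtoC K ^ 2 * RtoC (xi tau q) * RtoC mu * RtoC x)%C).
  { rewrite <- !RtoC_pow, <- RtoC_minus, <- !RtoC_mult. f_equal.
    unfold t1, t2. rewrite t_plus_sqr_diff; [|exact hd]. unfold K. field. exact hd. }
  assert (hdtC0 : (RtoC t1 ^ 2 - RtoC t2 ^ 2)%C <> RtoC 0).
  { rewrite <- !RtoC_pow, <- RtoC_minus. now apply RtoC_neq. }
  destruct (RtoC_sqrt_ex K) as [kap hkap].
  destruct (@sqrt_pair_ex (t1 ^ 2 - sigma) (t2 ^ 2 - sigma)
    (RtoC K * (RtoC (xi tau q) ^ 2 - RtoC sigma))%C) as (U1 & U2 & hU1 & hU2 & hU).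
  { rewrite <- (roots_sqr_prod hsum hprod). push_RtoC. ring. }
  destruct (@sqrt_pair_ex (sigma + 4 * s ^ 2 * tau - t1 ^ 2) (sigma + 4 * s ^ 2 * tau - t2 ^ 2)
    (2 * RtoC s * RtoC K * ((RtoC r ^ 2 * x2 q - RtoC tau * y2 q)
      - (RtoC r ^ 2 * x1 q - RtoC tau * y1 q)))%C) as (V1 & V2 & hV1 & hV2 & hV).
  { rewrite <- (radicand_V_prod H hK hsum hprod). push_RtoC. ring. }
  destruct (@sqrt_pair_ex (t1 + tau + r ^ 2) (t2 + tau + r ^ 2)
    (RtoC r * kap * (z1 q + z2 q))%C) as (M1 & M2 & hM1 & hM2 & hM).
  { transitivity (kap ^ 2 * RtoC r ^ 2 * (z1 q + z2 q) ^ 2)%C; [ring|].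
    rewrite hkap, <- (roots_shift_add H hK hsum hprod). push_RtoC. ring. }
  destruct (@sqrt_pair_ex (t1 + tau - r ^ 2) (t2 + tau - r ^ 2)
    (RtoC r * kap * (z1 q - z2 q))%C) as (N1 & N2 & hN1 & hN2 & hN).
  { transitivity (kap ^ 2 * RtoC r ^ 2 * (z1 q - z2 q) ^ 2)%C; [ring|].
    rewrite hkap, <- (roots_shift_sub H hK hsum hprod). push_RtoC. ring. }
  destruct (RtoC_sqrt_ex (s * tau)) as [st hst].
  set (k2 := RtoC (sqrt 2)).
  assert (hk2 : (k2 ^ 2)%C = RtoC 2).
  { unfold k2. rewrite <- RtoC_pow, pow2_sqrt; [reflexivity|lra]. }
  set (Q := (k2 * RtoC (xi tau q) * kap)%C).
  (* [U1 + U2] divides [U1 ^ 2 - U2 ^ 2 = t1 ^ 2 - t2 ^ 2]. *)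
  assert (hUn : (U1 + U2)%C <> RtoC 0).
  { intros E. apply hdtC0.
    transitivity (U1 ^ 2 - U2 ^ 2)%C; [rewrite hU1, hU2; push_RtoC; ring|].
    transitivity ((U1 - U2) * (U1 + U2))%C; [ring|]. rewrite E. ring. }
  assert (hU1' := hU1). assert (hU2' := hU2). assert (hV1' := hV1). assert (hV2' := hV2).
  assert (hM1' := hM1). assert (hM2' := hM2). assert (hN1' := hN1). assert (hN2' := hN2).
  assert (hst' := hst).
  rewrite RtoC_minus, RtoC_pow in hU1', hU2'.
  rewrite !RtoC_minus, RtoC_plus, !RtoC_mult, !RtoC_pow in hV1', hV2'.
  rewrite !RtoC_plus, RtoC_pow in hM1', hM2'.
  rewrite RtoC_minus, !RtoC_plus, RtoC_pow in hN1', hN2'.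
  rewrite RtoC_mult in hst'.
  assert (hrC : RtoC r <> RtoC 0) by now apply RtoC_neq.
  assert (hsC : RtoC s <> RtoC 0) by now apply RtoC_neq.
  assert (htC : RtoC tau <> RtoC 0) by now apply RtoC_neq.
  assert (hk20 : k2 <> RtoC 0) by exact (k2_neq0 hk2).
  assert (hst0 : st <> RtoC 0) by exact (q_neq0 hst' hsC htC).
  assert (hxx : (RtoC x ^ 2)%C = RtoC (x ^ 2)) by now rewrite RtoC_pow.
  assert (hne : (4 * RtoC K ^ 2 * RtoC (xi tau q) * RtoC mu * RtoC x)%C <> RtoC 0).
  { rewrite <- hdtC. nonzero. }
  assert (hxi0 : RtoC (xi tau q) <> RtoC 0) by (intros E; apply hne; rewrite E; ring).
  assert (hkap0 : kap <> RtoC 0) by (intros E; apply hne; rewrite <- hkap, E; ring).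
  (* [F1] is odd in the root of [s tau], so one of [st] and [- st] turns [F1 = w1] up to sign into
     equality. *)
  assert (hsign : exists c : C, (c ^ 2)%C = (RtoC s * RtoC tau)%C /\
    (Q / (4 * RtoC r * RtoC s * c) * ((M2 * N1 + M1 * N2) * (U1 * V2 + U2 * V1)
      / (RtoC t1 ^ 2 - RtoC t2 ^ 2)))%C = w1 q).
  { pose proof (F1_sqr H hK hsum hprod hkap hU1' hU2' hV1' hV2' hM1' hM2' hN1' hN2'
      hU hV hM hN hxx hmu2 hdtC hk2 hst' eq_refl hrC hsC htC hdtC0) as E.
    destruct (Csqr_eq E) as [E'|E'].
    - exists st. split; [exact hst'|exact E'].
    - exists (- st)%C. split; [rewrite <- hst'; ring|].
      transitivity (- - w1 q)%C; [|ring]. rewrite <- E'. unfold Q. field. auto. }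
  destruct hsign as [c [hc hF1]].
  assert (hc0 : c <> RtoC 0) by exact (q_neq0 hc hsC htC).
  pose proof (F1_F2 H hsum hkap hU1' hU2' hV1' hV2' hM1' hM2' hN1' hN2'
      hk2 hc eq_refl hrC hsC htC hdtC0) as hF2.
  pose proof (F1_F3 H hK hsum hprod hkap hU1' hU2' hV1' hV2' hM1' hM2' hN1' hN2'
      hU hV hM hN hxx hmu2 hdtC hk2 hc eq_refl hrC hsC htC hdtC0) as hF3.
  fold Q in hF2, hF3. rewrite hF1 in hF2, hF3.
  apply Cmult_cancel_l in hF2; [|exact (m3_w1_neq0 H)].
  apply Cmult_cancel_l in hF3; [|exact (m3_w1_neq0 H)].
  destruct (alpha_beta_explicit H hK hsum hprod hkap hU1' hU2' hU hV hM hN hrC hsC htC hUn)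
    as (hA1 & hA2 & hB1 & hB2).
  exists c, U1, U2, V1, V2, M1, M2, N1, N2, Q.
  do 9 (split; [first [assumption | now rewrite RtoC_mult]|]).
  split.
  (* Here [t1 t2 + sigma = K (xi ^ 2 + sigma)], which added to [U1 U2] gives [2 K xi ^ 2]. *)
  { rewrite (Q_sqr hkap hk2 (eq_refl Q)). rewrite RtoC_plus, RtoC_mult, hprod, hU. ring. }
  unfold explicit_solution. cbv zeta.
  assert (hcA : RtoC (calA p r tau t1 t2) = (((RtoC t1 + RtoC tau + RtoC r ^ 2)
    * (RtoC t2 + RtoC tau + RtoC r ^ 2)
    - 2 * (RtoC p ^ 2 + RtoC r ^ 2) * RtoC r ^ 2) * RtoC tau)%C).
  { unfold calA. push_RtoC. reflexivity. }
  assert (hcB : RtoC (calB p r tau t1 t2) = (((RtoC t1 + RtoC tau - RtoC r ^ 2)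
    * (RtoC t2 + RtoC tau - RtoC r ^ 2)
    + 2 * (RtoC p ^ 2 - RtoC r ^ 2) * RtoC r ^ 2) * RtoC tau)%C).
  { unfold calB. push_RtoC. reflexivity. }
  rewrite <- hcA in hA1, hA2. rewrite <- hcB in hB1, hB2.
  rewrite !RtoC_mult, !RtoC_pow, RtoC_minus, !RtoC_pow, RtoC_plus.
  rewrite hA1, hA2, hB1, hB2.
  fold k2.
  repeat split.
  - apply injective_projections; simpl; field.
  - apply injective_projections; simpl; field.
  - apply injective_projections; simpl; field.
  - apply injective_projections; simpl; field.
  - rewrite hM, hsum, <- hkap. unfold Q.
    transitivity ((z1 q + z2 q) / 2)%C; [|field; auto].
    apply injective_projections; simpl; field.
  - rewrite hN, hsum, <- hkap. unfold Q.
    transitivity (- Ci * ((z1 q - z2 q) / 2))%C; [|field; auto].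
    apply injective_projections; simpl; field.
  - transitivity ((w1 q + w2 q) / 2)%C; [apply injective_projections; simpl; field|].
    rewrite <- hF1, <- hF2. field. auto.
  - transitivity (- Ci * ((w1 q - w2 q) / 2))%C; [apply injective_projections; simpl; field|].
    rewrite <- hF1, <- hF2. field. auto.
  - symmetry. exact hF3.
Qed.

(** * The separated equation for one root *)

Lemma separated_equation (p r s tau sigma t : R) (q : R -> point) (x mu : R -> R) :
  m3_point (RtoC p) (RtoC r) (RtoC s) (RtoC tau) (RtoC sigma)
    (RtoC (x t ^ 2)) (RtoC (xi tau (q t)))
    (x1 (q t)) (x2 (q t)) (y1 (q t)) (y2 (q t)) (z1 (q t)) (z2 (q t))
    (w1 (q t)) (w2 (q t)) (w3 (q t)) ->
  top_equations q t -> s <> 0 -> tau <> 0 ->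
  x t <> 0 -> mu t <> 0 -> tau - x t ^ 2 <> 0 ->
  continuous x t -> continuous mu t ->
  locally t (fun u => x u ^ 2 = x1_norm_sqr (q u)) ->
  locally t (fun u => mu u ^ 2 = mu_sq tau sigma (x u) (xi tau (q u))) ->
  let t1 u := t_plus tau (x u) (xi tau (q u)) (mu u) in
  let t2 u := t_minus tau (x u) (xi tau (q u)) (mu u) in
  exists d : R, is_derive t1 t d /\
    ((t1 t - t2 t) * d) ^ 2 = 1 / (2 * s * tau) * (sigma + 4 * s ^ 2 * tau - t1 t ^ 2)
      * (t1 t ^ 2 - sigma) * (r ^ 4 - (t1 t + tau) ^ 2).
Proof.
  intros H Ht hs htau hx hmu hd cx cmu lx lmu t1 t2.
  destruct (is_derive_x1_norm_sqr Ht) as [dX [DX EX]].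
  destruct (is_derive_xi tau Ht) as [dxi [Dxi Exi]].
  pose proof (is_derive_continuous_sqrt cx hx lx DX) as Dx.
  (* [mu ^ 2] is a polynomial in [xi] and [x ^ 2], both differentiable, and [mu] is a continuous
     nonvanishing root of it. *)
  assert (Dmu : is_derive mu t ((2 * tau * xi tau (q t) * dxi + sigma * dX) / (2 * mu t))).
  { apply is_derive_continuous_sqrt
      with (fun u => tau * xi tau (q u) ^ 2 + (sigma * x1_norm_sqr (q u) + - (tau * sigma)));
      auto.
    - generalize (filter_and _ _ lx lmu). apply filter_imp.
      intros u [h1 h2]. rewrite h2, <- h1. unfold mu_sq. ring.
    - replace (2 * tau * xi tau (q t) * dxi + sigma * dX)
        with (tau * (2 * xi tau (q t) * dxi) + (sigma * dX + 0)) by ring.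
      apply (is_derive_plus (V := R_NormedModule)).
      + apply is_derive_scal, is_derive_sqr, Dxi.
      + apply (is_derive_plus (V := R_NormedModule)).
        * apply is_derive_scal, DX.
        * apply (is_derive_const (V := R_NormedModule)). }
  pose proof (locally_singleton _ _ lmu) as hmu2; simpl in hmu2.
  destruct (is_derive_t_plus (x := x) (xi := fun u => xi tau (q u)) (mu := mu) hx hmu hd hmu2 Dx Dxi Dmu)
    as [d [Dd Ed]].
  exists d; split; [exact Dd|].
  fold (t1 t) (t2 t) in Ed.
  assert (ht : (tau - x t ^ 2) * t1 t ^ 2 - 2 * tau * xi tau (q t) * t1 t
      + tau * xi tau (q t) ^ 2 + sigma * x t ^ 2 = 0).
  { apply (roots_iff _ hd hmu2). now left. }
  assert (V : 2 * s * tau * (tau * (t1 t - xi tau (q t)) * (2 * dxi)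
      + (t1 t ^ 2 - sigma) * dX) ^ 2
    = (tau - x t ^ 2) ^ 2 * (sigma + 4 * s ^ 2 * tau - t1 t ^ 2) * (t1 t ^ 2 - sigma)
      * (r ^ 4 - (t1 t + tau) ^ 2)).
  { apply RtoC_inj.
    assert (htC := f_equal RtoC ht).
    revert htC. push_RtoC. intros htC.
    rewrite RtoC_pow in H. rewrite RtoC_mult in Exi.
    apply (separated_velocity_sqr H htC); auto.
    apply Cpow_nz. now apply RtoC_neq. }
  apply (Rmult_eq_reg_l (2 * s * tau * (tau - x t ^ 2) ^ 2)).
  2:{ repeat apply Rmult_integral_contrapositive_currified; auto; lra. }
  transitivity (2 * s * tau * ((tau - x t ^ 2) * ((t1 t - t2 t) * d)) ^ 2); [ring|].
  rewrite Ed.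
  transitivity ((tau - x t ^ 2) ^ 2 * (sigma + 4 * s ^ 2 * tau - t1 t ^ 2)
    * (t1 t ^ 2 - sigma) * (r ^ 4 - (t1 t + tau) ^ 2)).
  - rewrite <- V. ring.
  - field. auto.
Qed.

(** * Assembly on the time interval *)

Unset Implicit Arguments.

Theorem mainTheorem2 (a b p r s tau sigma : R) (chi : C)
  (hb : 0 < b) (hab : b < a)
  (hp : 0 < p) (hr : 0 < r)
  (hp2 : p ^ 2 = a ^ 2 + b ^ 2) (hr2 : r ^ 2 = a ^ 2 - b ^ 2)
  (hstau : s * tau <> 0)
  (hsigma : sigma = tau ^ 2 - 2 * p ^ 2 * tau + r ^ 4)
  (hchi : (RtoC 4 * s ^ 2 * chi ^ 2)%C = RtoC (sigma + 4 * s ^ 2 * tau))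
  (lo hi : Rbar) (q : R -> point)
  (hsol : forall t, in_ivl lo hi t -> top_equations q t)
  (hM3 : forall t, in_ivl lo hi t -> in_M3 a b (q t))
  (hS : forall t, in_ivl lo hi t -> integralS (q t) = RtoC s)
  (hT : forall t, in_ivl lo hi t -> integralT (q t) = RtoC tau)
  (x : R -> R)
  (hxcont : forall t, in_ivl lo hi t -> continuous x t)
  (hx : forall t, in_ivl lo hi t ->
     RtoC (x t ^ 2) = (x1 (q t) * x2 (q t))%C) :
  (forall t, in_ivl lo hi t -> 0 <= mu_sq tau sigma (x t) (xi tau (q t))) /\
  (forall (lo' hi' : Rbar) (mu : R -> R),
     let t1 t := t_plus tau (x t) (xi tau (q t)) (mu t) in
     let t2 t := t_minus tau (x t) (xi tau (q t)) (mu t) in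
     (forall t, in_ivl lo' hi' t -> in_ivl lo hi t) ->
     (forall t, in_ivl lo' hi' t ->
        mu t ^ 2 = mu_sq tau sigma (x t) (xi tau (q t))) ->
     (forall t, in_ivl lo' hi' t ->
        x t <> 0 /\ x t ^ 2 <> tau /\ t1 t ^ 2 <> t2 t ^ 2) ->
     (* t1, t2 are the two roots of the quadratic equation *)
     (forall t, in_ivl lo' hi' t -> forall u : R,
        (tau - x t ^ 2) * u ^ 2 - 2 * tau * xi tau (q t) * u
          + tau * xi tau (q t) ^ 2 + sigma * x t ^ 2 = 0
        <-> u = t1 t \/ u = t2 t) /\
     (* (i) *)
     (forall t, in_ivl lo' hi' t ->
        exists sqst U1 U2 V1 V2 M1 M2 N1 N2 Q : C,
          (sqst ^ 2)%C = RtoC (s * tau) /\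
          (U1 ^ 2)%C = RtoC (t1 t ^ 2 - sigma) /\
          (U2 ^ 2)%C = RtoC (t2 t ^ 2 - sigma) /\
          (V1 ^ 2)%C = (RtoC 4 * s ^ 2 * chi ^ 2 - t1 t ^ 2)%C /\
          (V2 ^ 2)%C = (RtoC 4 * s ^ 2 * chi ^ 2 - t2 t ^ 2)%C /\
          (M1 ^ 2)%C = RtoC (t1 t + tau + r ^ 2) /\
          (M2 ^ 2)%C = RtoC (t2 t + tau + r ^ 2) /\
          (N1 ^ 2)%C = RtoC (t1 t + tau - r ^ 2) /\
          (N2 ^ 2)%C = RtoC (t2 t + tau - r ^ 2) /\
          (Q ^ 2)%C = (RtoC (t1 t * t2 t + sigma) + U1 * U2)%C /\
          explicit_solution p r s tau (t1 t) (t2 t)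
            sqst U1 U2 V1 V2 M1 M2 N1 N2 Q (q t)) /\
     (* (ii) *)
     ((forall t, in_ivl lo' hi' t -> continuous mu t) ->
      forall t, in_ivl lo' hi' t ->
        exists d1 d2 : R,
          is_derive t1 t d1 /\ is_derive t2 t d2 /\
          RtoC (((t1 t - t2 t) * d1) ^ 2) =
            (RtoC (1 / (2 * s * tau))
              * (RtoC 4 * s ^ 2 * chi ^ 2 - t1 t ^ 2)
              * RtoC (t1 t ^ 2 - sigma)
              * RtoC (r ^ 4 - (t1 t + tau) ^ 2))%C /\
          RtoC (((t1 t - t2 t) * d2) ^ 2) =
            (RtoC (1 / (2 * s * tau))
              * (RtoC 4 * s ^ 2 * chi ^ 2 - t2 t ^ 2)
              * RtoC (t2 t ^ 2 - sigma)
              * RtoC (r ^ 4 - (t2 t + tau) ^ 2))%C)).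
Proof.
  assert (hs : s <> 0) by (intros E; apply hstau; rewrite E; ring).
  assert (htau : tau <> 0) by (intros E; apply hstau; rewrite E; ring).
  assert (hr0 : r <> 0) by lra.
  assert (hm : forall t, in_ivl lo hi t ->
    m3_point (RtoC p) (RtoC r) (RtoC s) (RtoC tau) (RtoC sigma)
      (RtoC (x t ^ 2)) (RtoC (xi tau (q t)))
      (x1 (q t)) (x2 (q t)) (y1 (q t)) (y2 (q t)) (z1 (q t)) (z2 (q t))
      (w1 (q t)) (w2 (q t)) (w3 (q t))).
  { intros t Ht. apply (m3_point_of_in_M3 (a := a) (b := b)); auto. }
  split.
  - intros t Ht.
    (* [mu2] is the conjugate of [mu1], so [mu1 mu2] is a sum of two real squares. *)
    pose proof (m3_mu_mul (hm t Ht)) as E.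
    apply (f_equal Re) in E.
    replace (mu_sq tau sigma (x t) (xi tau (q t))) with
      (Re (RtoC tau * RtoC (xi tau (q t)) ^ 2 + RtoC sigma * RtoC (x t ^ 2)
        - RtoC tau * RtoC sigma)%C).
    + rewrite <- E.
      match goal with |- 0 <= ?e => replace e with
        ((r ^ 2 * Re (x1 (q t)) - tau * Re (y1 (q t))) ^ 2
         + (r ^ 2 * Im (x1 (q t)) - tau * Im (y1 (q t))) ^ 2) by (simpl; ring) end.
      apply Rplus_le_le_0_compat; apply pow2_ge_0.
    + unfold mu_sq. simpl. ring.
  - intros lo' hi' mu t1 t2 hsub hmu hne.
    assert (hd : forall t, in_ivl lo' hi' t -> tau - x t ^ 2 <> 0).
    { intros t Ht. destruct (hne t Ht) as (_ & h & _). lra. }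
    assert (hdt : forall t, in_ivl lo' hi' t -> t1 t ^ 2 - t2 t ^ 2 <> 0).
    { intros t Ht. destruct (hne t Ht) as (_ & _ & h). lra. }
    rewrite hchi.
    split; [|split].
    + intros t Ht u. apply roots_iff; auto.
    + intros t Ht.
      destruct (explicit_solution_exists (hm t (hsub t Ht)) hr0 hs htau (hd t Ht) (hmu t Ht)
        (hdt t Ht)) as (c & U1 & U2 & V1 & V2 & M1 & M2 & N1 & N2 & Q & E).
      exists c, U1, U2, V1, V2, M1, M2, N1, N2, Q.
      rewrite <- !RtoC_pow, <- !RtoC_minus. exact E.
    + intros cmu t Ht.
      assert (hmu0 : mu t <> 0).
      { intros E. apply (hdt t Ht). unfold t1, t2. rewrite E, t_plus_sqr_diff; [|auto].
        field. auto. }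
      assert (lx : locally t (fun u => x u ^ 2 = x1_norm_sqr (q u))).
      { generalize (in_ivl_locally Ht). apply filter_imp. intros u Hu.
        apply RtoC_inj. rewrite hx by auto. apply x1_norm_sqrE. }
      assert (lmu : locally t (fun u => mu u ^ 2 = mu_sq tau sigma (x u) (xi tau (q u)))).
      { generalize (in_ivl_locally Ht). apply filter_imp. exact hmu. }
      destruct (hne t Ht) as (hx0 & _ & _).
      destruct (separated_equation (x := x) (mu := mu) (hm t (hsub t Ht)) (hsol t (hsub t Ht)) hs htau
        hx0 hmu0 (hd t Ht) (hxcont t (hsub t Ht)) (cmu t Ht) lx lmu) as [d1 [D1 E1]].
      (* Replacing [mu] by [- mu] makes [t2] the first root. *)
      destruct (separated_equation (x := x) (mu := fun u => - mu u) (hm t (hsub t Ht)) (hsol t (hsub t Ht))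
        hs htau hx0 (Ropp_neq_0_compat _ hmu0) (hd t Ht) (hxcont t (hsub t Ht))
        (continuous_opp (V := R_NormedModule) mu t (cmu t Ht)) lx) as [d2 [D2 E2]].
      { revert lmu. apply filter_imp. intros u hu. rewrite <- hu. ring. }
      exists d1, d2. split; [exact D1|]. split.
      { revert D2. apply is_derive_ext. intros u. unfold t2. now rewrite t_minus_opp. }
      rewrite <- t_minus_opp, <- t_plus_opp in E2.
      rewrite <- !RtoC_pow, <- !RtoC_minus, <- !RtoC_mult.
      split; f_equal.
      * exact E1.
      * fold (t1 t) (t2 t) in E2. rewrite <- E2. ring.
Qed.
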